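(* Let $\&$ be a continuous t-norm on $[0,1]$ that satisfies the condition (S). Then the following statements are equivalent: (1) $\&$ is isomorphic to the Łukasiewicz t-norm. (2) Every continuous $[0,1]$-lattice, endowed with its Scott $[0,1]$-approach structure, is injective; that is, for every continuous $[0,1]$-lattice $X$ the $[0,1]$-approach space $\Sigma X$ is injective.
   Context: A continuous t-norm is a continuous map $\&:[0,1]^2\to[0,1]$, monotone in each variable, making $([0,1],\&,1)$ a commutative monoid. Its implication is $x\to y=\sup\{z\mid x\& z\le y\}$, so $x\& z\le y\iff z\le x\to y$. $\&$ satisfies condition (S) if the implication $\to:[0,1]\times[0,1]\to[0,1]$ is continuous at each point off the diagonal $\{(x,x)\mid x\in[0,1]\}$. The Łukasiewicz t-norm is $x\&_{Ł}y=\max\{0,x+y-1\}$; $\&$ is isomorphic to it if there is an order isomorphism $\theta:[0,1]\to[0,1]$ with $\theta(x\& y)=\theta(x)\&_{Ł}\theta(y)$. A $[0,1]$-order on a set $X$ is a map $X(-,-):X\times X\to[0,1]$ with $X(x,x)=1$ and $X(y,z)\& X(x,y)\le X(x,z)$. It is separated if $X(x,y)=X(y,x)=1$ implies $x=y$. A weight of $X$ is a map $\phi:X\to[0,1]$ with $\phi(y)\& X(x,y)\le\phi(x)$. For maps $\phi,\psi:X\to[0,1]$ put $\mathrm{sub}_X(\phi,\psi)=\inf_{x\in X}(\phi(x)\to\psi(x))$. An element $a$ is a supremum of a weight $\phi$, $a=\sup\phi$, if $X(a,y)=\mathrm{sub}_X(\phi,X(-,y))$ for all $y$. $X$ is a complete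 $[0,1]$-lattice if it is separated and every weight has a supremum. A net $\{x_i\}_i$ (indexed by a non-empty directed set) in $X$ is forward Cauchy if $\sup_i\inf_{i\le j\le l}X(x_j,x_l)=1$; a weight is forward Cauchy if it has the form $\sup_i\inf_{j\ge i}X(-,x_j)$ for some forward Cauchy net. $\mathcal{D}X$ is the set of forward Cauchy weights with $[0,1]$-order $\mathrm{sub}_X$. A map $f:X\to Y$ is left adjoint to $g:Y\to X$ if $Y(f(x),y)=X(x,g(y))$ for all $x,y$. A separated $X$ is a $[0,1]$-domain if $\mathsf{y}:X\to\mathcal{D}X$, $x\mapsto X(-,x)$, has a left adjoint $\sup:\mathcal{D}X\to X$ (sending each forward Cauchy weight to its supremum) and $\sup$ has a left adjoint $\mathsf{d}:X\to\mathcal{D}X$. A continuous $[0,1]$-lattice is a complete $[0,1]$-lattice that is a $[0,1]$-domain. A $[0,1]$-approach structure on a set $X$ is a map $\delta:X\times 2^X\to[0,1]$ with: $\delta(x,\{x\})=1$; $\delta(x,\varnothing)=0$; $\delta(x,A\cup B)=\delta(x,A)\vee\delta(x,B)$; $\delta(x,A)\ge\big(\inf_{b\in B}\delta(b,A)\big)\&\delta(x,B)$. A map $f$ between $[0,1]$-approach spaces is continuous if $\delta_X(x,A)\le\delta_Y(f(x),f(A))$ for all $x,A$. A subspace on $Y\subseteq X$ is obtained by restricting $\delta$ to $Y\times 2^Y$. A $[0,1]$-approach space $Z$ is injective if every continuous map from a subspace of a $[0,1]$-approach space $X$ to $Z$ extends to a continuous map $X\to Z$. A weight $\phi$ of a $[0,1]$-ordered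 set $X$ is Scott closed if $\mathrm{sub}_X(\lambda,\phi)=\phi(\sup\lambda)$ for every forward Cauchy weight $\lambda$ of $X$ having a supremum. The Scott $[0,1]$-approach structure of $X$ is $\delta(x,A)=\inf\{\phi(x)\mid\phi\text{ a Scott closed weight of }X,\ \phi(a)=1\text{ for all }a\in A\}$; $\Sigma X$ denotes $X$ with this structure. *)

(* Defs.v *)
From HB Require Import structures.
From mathcomp Require Import all_boot all_order all_algebra.
From mathcomp Require Import interval_inference.
From mathcomp Require Import all_classical all_reals.
From mathcomp Require Import topology normedtype.

Set Implicit Arguments.
Unset Strict Implicit.
Unset Printing Implicit Defensive.

Import Order.TTheory GRing.Theory Num.Theory.
Import numFieldNormedType.Exports.

Local Open Scope classical_set_scope.
Local Open Scope ring_scope.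

(* [{i01 R}] carries the subspace topology of [0, 1] inside [R]. *)
HB.instance Definition _ (R : realType) :=
  PseudoMetric.copy {i01 R}
    (initial_topology (fun x : {i01 R} => x%:num : R)).

(* Suprema and infima in the complete lattice [0, 1]; the defaults of
   [supremum] and [infimum] give sup set0 = 0 and inf set0 = 1, and the lemmas
   [isupP] and [iinfP] below show that the defaults matter only there. *)
Definition isup (R : realType) (A : set {i01 R}) : {i01 R} :=
  supremum 0%:i01 A.

Definition iinf (R : realType) (A : set {i01 R}) : {i01 R} :=
  infimum 1%:i01 A.

Lemma isupP (R : realType) (A : set {i01 R}) : supremums A (isup A).
Proof.
rewrite /isup /supremum; case: ifPn => [/eqP ->|/set0P[a Aa]].
  by split=> [x []|x _]; rewrite -num_le /= ge0.
have hs : has_sup ((fun x : {i01 R} => x%:num) @` A).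
  by split; [exists a%:num; exists a | exists 1 => _ [x _ <-]; rewrite le1].
have s0 : 0 <= sup ((fun x : {i01 R} => x%:num) @` A).
  apply: (@le_trans _ _ a%:num); first by rewrite ge0.
  by apply: ub_le_sup; [case: hs | exists a].
have s1 : sup ((fun x : {i01 R} => x%:num) @` A) <= 1.
  by apply: ge_sup; [case: hs | move=> _ [x _ <-]; rewrite le1].
have sA : supremums A (Itv01 s0 s1 : {i01 R}).
  split=> [x Ax|x Ux]; rewrite -num_le /=.
    by apply: ub_le_sup; [case: hs | exists x].
  by apply: ge_sup; [case: hs | move=> _ [z Az <-]; rewrite num_le; exact: Ux].
exact: (xgetPex _ (ex_intro _ _ sA)).
Qed.

Lemma iinfP (R : realType) (A : set {i01 R}) : infimums A (iinf A).
Proof.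
rewrite /iinf /infimum; case: ifPn => [/eqP ->|/set0P[a Aa]].
  by split=> [x []|x _]; rewrite -num_le /= le1.
have lA : infimums A (isup (lbound A)).
  have [ub lub] := isupP (lbound A).
  by split=> [x Ax|x]; [apply: lub => z; exact | exact: ub].
exact: (xgetPex _ (ex_intro _ _ lA)).
Qed.

Record continuous_tnorm (R : realType) (T : {i01 R} -> {i01 R} -> {i01 R})
    : Prop := ContinuousTnorm {
  tnorm_continuous : continuous (fun p : {i01 R} * {i01 R} => T p.1 p.2);
  tnorm_monol : forall x y z, x <= y -> T x z <= T y z;
  tnorm_monor : forall x y z, x <= y -> T z x <= T z y;
  tnormA : associative T;
  tnormC : commutative T;
  tnorm1 : left_id 1%:i01 T }.

Definition imp (R : realType) (T : {i01 R} -> {i01 R} -> {i01 R})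
    (x y : {i01 R}) : {i01 R} :=
  isup [set z | T x z <= y].

Definition condition_S (R : realType) (T : {i01 R} -> {i01 R} -> {i01 R})
    : Prop :=
  forall x y : {i01 R}, x != y ->
    {for (x, y), continuous (fun p : {i01 R} * {i01 R} => imp T p.1 p.2)}.

Definition lukasiewicz (R : realType) (x y : {i01 R}) : {i01 R} :=
  (Num.max 0 (x%:num + y%:num - 1))%:i01.

Definition tnorm_isomorphic (R : realType)
    (T T' : {i01 R} -> {i01 R} -> {i01 R}) : Prop :=
  exists theta : {i01 R} -> {i01 R},
    [/\ bijective theta, {mono theta : x y / x <= y}
      & {morph theta : x y / T x y >-> T' x y}].

Record iorder (R : realType) (T : {i01 R} -> {i01 R} -> {i01 R}) := IOrder {
  iorder_car :> Type;
  ihom : iorder_car -> iorder_car -> {i01 R};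
  ihom_refl : forall x, ihom x x = 1%:i01;
  ihom_trans : forall x y z, T (ihom y z) (ihom x y) <= ihom x z }.

Definition iseparated (R : realType) (T : {i01 R} -> {i01 R} -> {i01 R})
    (X : iorder T) : Prop :=
  forall x y : X, ihom x y = 1%:i01 -> ihom y x = 1%:i01 -> x = y.

Definition weight (R : realType) (T : {i01 R} -> {i01 R} -> {i01 R})
    (X : iorder T) (phi : X -> {i01 R}) : Prop :=
  forall x y : X, T (phi y) (ihom x y) <= phi x.

Definition isub (R : realType) (T : {i01 R} -> {i01 R} -> {i01 R})
    (X : Type) (phi psi : X -> {i01 R}) : {i01 R} :=
  iinf (range (fun x => imp T (phi x) (psi x))).

Definition is_sup (R : realType) (T : {i01 R} -> {i01 R} -> {i01 R})
    (X : iorder T) (phi : X -> {i01 R}) (a : X) : Prop :=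
  forall y : X, ihom a y = isub T phi (fun x => ihom x y).

Definition complete_lattice (R : realType)
    (T : {i01 R} -> {i01 R} -> {i01 R}) (X : iorder T) : Prop :=
  iseparated X /\ forall phi : X -> {i01 R}, weight phi -> exists a, is_sup phi a.

Record directed (J : Type) (leJ : J -> J -> Prop) : Prop := Directed {
  directed_inhabited : inhabited J;
  directed_refl : forall i, leJ i i;
  directed_trans : forall i j k, leJ i j -> leJ j k -> leJ i k;
  directed_ub : forall i j, exists k, leJ i k /\ leJ j k }.

Definition forward_cauchy (R : realType) (T : {i01 R} -> {i01 R} -> {i01 R})
    (X : iorder T) (J : Type) (leJ : J -> J -> Prop) (u : J -> X) : Prop :=
  isup (range (fun i =>
    iinf [set t | exists j l, [/\ leJ i j, leJ j l & t = ihom (u j) (u l)]]))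
  = 1%:i01.

Definition net_weight (R : realType) (T : {i01 R} -> {i01 R} -> {i01 R})
    (X : iorder T) (J : Type) (leJ : J -> J -> Prop) (u : J -> X)
    (x : X) : {i01 R} :=
  isup (range (fun i => iinf [set ihom x (u j) | j in leJ i])).

Definition forward_cauchy_weight (R : realType)
    (T : {i01 R} -> {i01 R} -> {i01 R}) (X : iorder T)
    (phi : X -> {i01 R}) : Prop :=
  weight phi /\
  exists (J : Type) (leJ : J -> J -> Prop) (u : J -> X),
    [/\ directed leJ, forward_cauchy leJ u & phi = net_weight leJ u].

Definition fcw (R : realType) (T : {i01 R} -> {i01 R} -> {i01 R})
    (X : iorder T) : Type :=
  {phi : X -> {i01 R} | forward_cauchy_weight phi}.

Definition fcw_hom (R : realType) (T : {i01 R} -> {i01 R} -> {i01 R})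
    (X : iorder T) (phi psi : fcw X) : {i01 R} :=
  isub T (sval phi) (sval psi).

Lemma representable_fcw (R : realType) (T : {i01 R} -> {i01 R} -> {i01 R})
  (X : iorder T) (x : X) : forward_cauchy_weight (fun y : X => ihom y x).
Proof.
split; first by move=> y z; exact: ihom_trans.
have inf1 (t : {i01 R}) : iinf [set t] = t.
  have [lb glb] := iinfP [set t].
  by apply/eqP; rewrite eq_le lb //=; apply: glb => _ ->.
have sup1 (t : {i01 R}) : isup [set t] = t.
  have [ub lub] := isupP [set t].
  by apply/eqP; rewrite eq_le ub // andbT; apply: lub => _ ->.
have rng (t : {i01 R}) : range (fun _ : unit => t) = [set t].
  by apply/seteqP; split=> [_ [_ _ <-]|_ ->] //; exists tt.
exists unit, (fun _ _ => True), (fun=> x); split.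
- by split=> //; exists tt.
- rewrite /forward_cauchy rng sup1 -[RHS]inf1; congr iinf.
  by apply/seteqP; split=> [_ [_ [_ [_ _ ->]]]|_ ->] /=;
    [rewrite ihom_refl | exists tt, tt; rewrite ihom_refl].
- apply/funext => y; rewrite /net_weight rng sup1 -[LHS]inf1; congr iinf.
  by apply/seteqP; split=> [_ ->|_ [_ _ <-]] //; exists tt.
Qed.

Definition yoneda (R : realType) (T : {i01 R} -> {i01 R} -> {i01 R})
    (X : iorder T) (x : X) : fcw X :=
  exist _ (fun y : X => ihom y x) (representable_fcw x).

Definition left_adjoint (R : realType) (X Y : Type) (hX : X -> X -> {i01 R})
    (hY : Y -> Y -> {i01 R}) (f : X -> Y) (g : Y -> X) : Prop :=
  forall x y, hY (f x) y = hX x (g y).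

Definition idomain01 (R : realType) (T : {i01 R} -> {i01 R} -> {i01 R})
    (X : iorder T) : Prop :=
  iseparated X /\
  exists s : fcw X -> X,
    left_adjoint (@fcw_hom R T X) (@ihom R T X) s (@yoneda R T X) /\
    exists d : X -> fcw X,
      left_adjoint (@ihom R T X) (@fcw_hom R T X) d s.

Definition continuous_lattice (R : realType)
    (T : {i01 R} -> {i01 R} -> {i01 R}) (X : iorder T) : Prop :=
  complete_lattice X /\ idomain01 X.

Record approach (R : realType) (T : {i01 R} -> {i01 R} -> {i01 R}) (X : Type)
    (delta : X -> set X -> {i01 R}) : Prop := Approach {
  approach1 : forall x, delta x [set x] = 1%:i01;
  approach0 : forall x, delta x set0 = 0%:i01;
  approachU : forall x A B,
    delta x (A `|` B) = Order.max (delta x A) (delta x B);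
  approachT : forall x A B,
    T (iinf [set delta b A | b in B]) (delta x B) <= delta x A }.

Definition approach_continuous (R : realType) (X Y : Type)
    (dX : X -> set X -> {i01 R}) (dY : Y -> set Y -> {i01 R})
    (f : X -> Y) : Prop :=
  forall x A, dX x A <= dY (f x) (f @` A).

Definition subspace_dist (R : realType) (X : Type)
    (dX : X -> set X -> {i01 R}) (Y : set X) (y : Y) (A : set Y) : {i01 R} :=
  dX (set_val y) (set_val @` A).

(* Injectivity is a property of approach spaces, so it includes the approach
   axioms for [dZ]. *)
Definition injective_space (R : realType)
    (T : {i01 R} -> {i01 R} -> {i01 R}) (Z : Type)
    (dZ : Z -> set Z -> {i01 R}) : Prop :=
  approach T dZ /\
  forall (X : Type) (dX : X -> set X -> {i01 R}), approach T dX ->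
  forall (Y : set X) (f : Y -> Z),
    approach_continuous (@subspace_dist R X dX Y) dZ f ->
    exists g : X -> Z,
      approach_continuous dX dZ g /\ forall y : Y, g (set_val y) = f y.

Definition scott_closed (R : realType) (T : {i01 R} -> {i01 R} -> {i01 R})
    (X : iorder T) (phi : X -> {i01 R}) : Prop :=
  weight phi /\
  forall (lambda : X -> {i01 R}) (a : X),
    forward_cauchy_weight lambda -> is_sup lambda a ->
    isub T lambda phi = phi a.

Definition scott_dist (R : realType) (T : {i01 R} -> {i01 R} -> {i01 R})
    (X : iorder T) (x : X) (A : set X) : {i01 R} :=
  iinf [set phi x | phi in
    [set phi : X -> {i01 R} |
      scott_closed phi /\ forall a, A a -> phi a = 1%:i01]].

(* Main.v *)
Require Import Defs.
From mathcomp Require Import all_boot all_order all_algebra.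
From mathcomp Require Import interval_inference.
From mathcomp Require Import all_classical all_reals.
From mathcomp Require Import topology normedtype lra.

(** Write [neg x] for [imp T x 0].

    From Lukasiewicz to injectivity.  The Scott approach axioms hold for every
    continuous t-norm; the one with content, on unions, is [scott_closed_max].
    For the extension property, what matters about the Lukasiewicz t-norm is that
    [neg] is an involution, so that closed functions, which are stable under
    finite maxima and multiples, have a dual notion of open function, and that the
    powers of any [r < 1] reach 0.  Let [Z] be a continuous lattice.  As in the
    classical case, a map [f] from a subspace [Y] of [X] to [Z] is extended by its
    lower limit: the value at [p] is the supremum, over the open functions [U] on
    [X] with [U p = 1], of the infimum of the values of [f] weighted by [U]
    ([extension_exists]).  These weighted infima form a directed family, which is
    why the supremum is one of a forward Cauchy weight and commutes with Scott
    closed weights; continuity follows.  For the extension to agree with [f] on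
    [Y], the space [X] must have enough open functions.  They come from the
    way-below degrees of [Z], which are Scott open by interpolation
    ([way_below_sup]), pulled back along [f] and extended from [Y] to [X] by a
    finite partition of their values ([closed_map_extend]).

    From injectivity to Lukasiewicz.  Under condition (S) the interval itself,
    ordered by [imp T], is a continuous lattice
    ([interval_continuous_lattice]).  Testing its injectivity on a two-point
    subspace of the interval, with the approach structure that classifies closed
    functions, shows that [imp T t a] tends to 1 as [t] decreases to [a], for
    every [a < 1] ([imp_near_diagonal]).  With (S) this excludes idempotents other
    than 0 and 1, and at [a = 0] it yields a non-zero element of square 0.  A
    continuous t-norm with these two properties is isomorphic to the Lukasiewicz
    one: let [half] be the largest element of square 0 and take iterated square
    roots of it.  Their powers define an exponential on the dyadic numbers of
    the unit interval, which is strictly decreasing and dense in its values, and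
    whose inverse turns the t-norm into truncated addition
    ([tnorm_isomorphic_lukasiewicz]). *)

Set Implicit Arguments.
Unset Strict Implicit.
Unset Printing Implicit Defensive.

Import Order.TTheory GRing.Theory Num.Theory.
Import numFieldNormedType.Exports.

Local Open Scope classical_set_scope.
Local Open Scope ring_scope.

(** * Suprema, infima and continuity in the unit interval *)

Section UnitInterval.
Context {R : realType}.
Local Notation I := {i01 R}.
Implicit Types (x y z r s : I) (A : set I).

Lemma i01_ge0 x : 0%:i01 <= x. Proof. by rewrite -num_le /= ge0. Qed.
Lemma i01_le1 x : x <= 1%:i01. Proof. by rewrite -num_le /= le1. Qed.

Lemma i01_le0 x : x <= 0%:i01 -> x = 0%:i01.
Proof. by move=> x0; apply/eqP; rewrite eq_le x0 i01_ge0. Qed.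

Lemma i01_ge1 x : 1%:i01 <= x -> x = 1%:i01.
Proof. by move=> x1; apply/eqP; rewrite eq_le x1 i01_le1. Qed.

Lemma i01_lt01 : 0%:i01 < 1%:i01 :> I.
Proof. by rewrite -num_lt /= ltr01. Qed.

Lemma i01_dense x y : x < y -> exists2 z, x < z & z < y.
Proof.
rewrite -num_lt => xy.
have z0 : 0 <= (x%:num + y%:num) / 2%:R.
  by rewrite divr_ge0 ?addr_ge0 ?ge0.
have z1 : (x%:num + y%:num) / 2%:R <= 1.
  have : x%:num <= 1 :> R by rewrite le1.
  have : y%:num <= 1 :> R by rewrite le1.
  lra.
by exists (Itv01 z0 z1); rewrite -num_lt /=; lra.
Qed.

Lemma isup_ub A x : A x -> x <= isup A.
Proof. by move=> Ax; have [ub _] := isupP A; exact: ub. Qed.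

Lemma isup_le A y : (forall x, A x -> x <= y) -> isup A <= y.
Proof. by move=> Ay; have [_ lub] := isupP A; exact: lub. Qed.

Lemma iinf_lb A x : A x -> iinf A <= x.
Proof. by move=> Ax; have [lb _] := iinfP A; exact: lb. Qed.

Lemma le_iinf A y : (forall x, A x -> y <= x) -> y <= iinf A.
Proof. by move=> Ay; have [_ glb] := iinfP A; exact: glb. Qed.

Lemma lt_isup A r : r < isup A -> exists2 x, A x & r < x.
Proof.
move=> rA; apply: contrapT => nA; suff: isup A <= r by rewrite leNgt rA.
apply: isup_le => x Ax; rewrite leNgt; apply/negP => rx; apply: nA; by exists x.
Qed.

Lemma iinf_lt A r : iinf A < r -> exists2 x, A x & x < r.
Proof.
move=> rA; apply: contrapT => nA; suff: r <= iinf A by rewrite leNgt rA.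
apply: le_iinf => x Ax; rewrite leNgt; apply/negP => rx; apply: nA; by exists x.
Qed.

Lemma le_of_lt x y : (forall r, r < x -> r <= y) -> x <= y.
Proof.
move=> xy; rewrite leNgt; apply/negP => /i01_dense[z yz zx].
by have := xy _ zx; rewrite leNgt yz.
Qed.

Lemma ge_of_gt x y : (forall s, y < s -> x <= s) -> x <= y.
Proof.
move=> xy; rewrite leNgt; apply/negP => /i01_dense[z yz zx].
by have := xy _ yz; rewrite leNgt zx.
Qed.

(** This lemma and the next turn topological continuity into preservation of
    suprema and infima of non-empty sets. *)
Lemma isup_adherent A (U : set I) :
  A !=set0 -> nbhs (isup A) U -> exists2 a, A a & U a.
Proof.
move=> [a0 Aa0] [V [[W oW <-] WA] VU].
have /nbhs_ballP[/= e e0 We] : nbhs ((isup A)%:num : R) W.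
  by apply: open_nbhs_nbhs.
have near_isup a : A a -> (isup A)%:num - e < a%:num -> U a.
  move=> Aa ea; apply: VU; apply: We; rewrite /ball /= ger0_norm.
    by rewrite ltrBlDr -ltrBlDl.
  by rewrite subr_ge0 num_le isup_ub.
have [e1|e1] := ltP ((isup A)%:num - e) 0.
  by exists a0 => //; apply: near_isup => //; apply: lt_le_trans e1 _; rewrite ge0.
have e2 : (isup A)%:num - e <= 1.
  by rewrite (le_trans _ (le1 (isup A)))// gerBl ltW.
have [a Aa ea] : exists2 a, A a & Itv01 e1 e2 < a.
  by apply: lt_isup; rewrite -num_lt /= gtrBl.
by exists a => //; apply: near_isup => //; rewrite -num_lt in ea.
Qed.

Lemma iinf_adherent A (U : set I) :
  A !=set0 -> nbhs (iinf A) U -> exists2 a, A a & U a.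
Proof.
move=> [a0 Aa0] [V [[W oW <-] WA] VU].
have /nbhs_ballP[/= e e0 We] : nbhs ((iinf A)%:num : R) W.
  by apply: open_nbhs_nbhs.
have near_iinf a : A a -> a%:num < (iinf A)%:num + e -> U a.
  move=> Aa ea; apply: VU; apply: We; rewrite /ball /= distrC ger0_norm.
    by rewrite ltrBlDl.
  by rewrite subr_ge0 num_le iinf_lb.
have [e1|e1] := ltP 1 ((iinf A)%:num + e).
  by exists a0 => //; apply: near_iinf => //; apply: le_lt_trans e1; rewrite le1.
have e2 : 0 <= (iinf A)%:num + e.
  by rewrite (le_trans (ge0 (iinf A)))// lerDl ltW.
have [a Aa ea] : exists2 a, A a & a < Itv01 e2 e1.
  by apply: iinf_lt; rewrite -num_lt /= ltrDl.
by exists a => //; apply: near_iinf => //; rewrite -num_lt in ea.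
Qed.

Lemma open_i01_gt r : open [set z : I | r < z].
Proof.
exists [set y : R | r%:num < y]; first exact: open_gt.
by apply/seteqP; split=> z /=; rewrite num_lt.
Qed.

Lemma open_i01_lt r : open [set z : I | z < r].
Proof.
exists [set y : R | y < r%:num]; first exact: open_lt.
by apply/seteqP; split=> z /=; rewrite num_lt.
Qed.

Lemma continuous_lt_isup (h : I -> I) A r :
  {for isup A, continuous h} -> A !=set0 -> r < h (isup A) ->
  exists2 a, A a & r < h a.
Proof.
move=> hA A0 rh; apply: (isup_adherent A0).
have : nbhs (h (isup A)) [set z | r < z].
  by apply: open_nbhs_nbhs; split=> //; exact: open_i01_gt.
by move/hA.
Qed.

Lemma continuous_iinf_lt (h : I -> I) A r :
  {for iinf A, continuous h} -> A !=set0 -> h (iinf A) < r ->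
  exists2 a, A a & h a < r.
Proof.
move=> hA A0 rh; apply: (iinf_adherent A0).
have : nbhs (h (iinf A)) [set z | z < r].
  by apply: open_nbhs_nbhs; split=> //; exact: open_i01_lt.
by move/hA.
Qed.

Lemma continuous_at_pair (F : I * I -> I) x y :
  {for (x, y), continuous F} -> {for y, continuous (fun z => F (x, z))}.
Proof.
move=> cF; apply: (@continuous_comp _ _ _ (fun z => (x, z)) F) => // U.
apply: (@cvg_pair _ _ _ (nbhs y) (nbhs x) (nbhs y) _ _ _ (fun=> x) id).
  exact: cvg_cst.
exact: cvg_id.
Qed.

Lemma isup_lt x : isup [set s | s < x] = x.
Proof.
apply/eqP; rewrite eq_le isup_le/= ?le_of_lt// => [s sx|s /ltW//].
exact: isup_ub.
Qed.

Lemma iinf_gt x : x < 1%:i01 -> iinf [set s | x < s] = x.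
Proof.
move=> x1; apply/eqP; rewrite eq_le le_iinf/= ?andbT => [|s /ltW//].
by apply: ge_of_gt => s xs; exact: iinf_lb.
Qed.

Lemma iinf_set1 x : iinf [set x] = x.
Proof.
by apply/eqP; rewrite eq_le iinf_lb//; apply: le_iinf => _ ->.
Qed.

End UnitInterval.

(** * Continuous t-norms and residuation *)

Definition tnorm_neg (R : realType) (T : {i01 R} -> {i01 R} -> {i01 R})
    (x : {i01 R}) : {i01 R} :=
  imp T x 0%:i01.

Definition tpow (R : realType) (T : {i01 R} -> {i01 R} -> {i01 R})
    (x : {i01 R}) (n : nat) : {i01 R} :=
  iter n (T x) 1%:i01.

Section TNorm.
Context {R : realType} (T : {i01 R} -> {i01 R} -> {i01 R}).
Context (hT : continuous_tnorm T).
Local Notation I := {i01 R}.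
Implicit Types (x y z r s : I) (A : set I).

Lemma tnorm_mono x x' y y' : x <= x' -> y <= y' -> T x y <= T x' y'.
Proof.
move=> xx yy; apply: le_trans (tnorm_monol hT _ xx) _; exact: (tnorm_monor hT).
Qed.

Lemma tnorm1r x : T x 1%:i01 = x.
Proof. by rewrite (tnormC hT) (tnorm1 hT). Qed.

Lemma tnorm_le_l x y : T x y <= x.
Proof. by rewrite -[leRHS]tnorm1r; apply: (tnorm_monor hT); exact: i01_le1. Qed.

Lemma tnorm_le_r x y : T x y <= y.
Proof. by rewrite (tnormC hT) tnorm_le_l. Qed.

Lemma tnorm0r x : T x 0%:i01 = 0%:i01.
Proof. by apply: i01_le0; exact: tnorm_le_r. Qed.

Lemma tnorm0 x : T 0%:i01 x = 0%:i01.
Proof. by apply: i01_le0; exact: tnorm_le_l. Qed.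

Lemma tnorm_continuous_at x y : {for y, continuous (T x)}.
Proof.
exact: (@continuous_at_pair R (fun p => T p.1 p.2) x y
  (@tnorm_continuous _ _ hT (x, y))).
Qed.

Lemma tnorm_lt_isup x A r : r < T x (isup A) -> exists2 a, A a & r < T x a.
Proof.
move=> rA; apply: (continuous_lt_isup (@tnorm_continuous_at x _)) => //.
apply: contrapT => /set0P/negP/negPn/eqP A0; move: rA.
rewrite A0 (_ : isup set0 = 0%:i01) ?tnorm0r; last by apply: i01_le0; apply: isup_le.
by rewrite ltNge i01_ge0.
Qed.

Lemma tnorm_isup_le x A y :
  (forall a, A a -> T x a <= y) -> T x (isup A) <= y.
Proof.
move=> Ay; rewrite leNgt; apply/negP => /tnorm_lt_isup[a /Ay].
by rewrite leNgt => /negPf->.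
Qed.

Lemma tnorm_iinf_lt x A r :
  A !=set0 -> T x (iinf A) < r -> exists2 a, A a & T x a < r.
Proof. by move=> A0; apply: (continuous_iinf_lt (@tnorm_continuous_at x _)). Qed.

Lemma le_tnorm_iinf x A y : A !=set0 ->
  (forall a, A a -> y <= T x a) -> y <= T x (iinf A).
Proof.
move=> A0 Ay; rewrite leNgt; apply/negP => /(tnorm_iinf_lt A0)[a /Ay].
by rewrite leNgt => /negPf->.
Qed.

Lemma le_imp x y z : (z <= imp T x y) = (T x z <= y).
Proof.
apply/idP/idP => [zi|]; last by move=> h; exact: isup_ub.
apply: le_trans (tnorm_monor hT _ zi) _.
by apply: tnorm_isup_le.
Qed.

Lemma imp_app x y : T x (imp T x y) <= y.
Proof. by rewrite -le_imp. Qed.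

Lemma imp_mono x x' y y' : x' <= x -> y <= y' -> imp T x y <= imp T x' y'.
Proof.
move=> xx yy; rewrite le_imp; apply: le_trans yy; rewrite -le_imp.
by rewrite le_imp; apply: le_trans (imp_app x y); exact: (tnorm_monol hT).
Qed.

Lemma imp1 x y : x <= y -> imp T x y = 1%:i01.
Proof. by move=> xy; apply: i01_ge1; rewrite le_imp tnorm1r. Qed.

Lemma imp_eq1 x y : (imp T x y == 1%:i01) = (x <= y).
Proof.
apply/eqP/idP => [i1|/imp1//]; by rewrite -(tnorm1r x) -le_imp i1.
Qed.

Lemma imp1l y : imp T 1%:i01 y = y.
Proof.
apply/eqP; rewrite eq_le le_imp (tnorm1 hT) lexx andbT.
by rewrite -{1}(tnorm1 hT (imp T _ _)) imp_app.
Qed.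

Lemma imp_curry x y z : imp T (T x y) z = imp T x (imp T y z).
Proof.
by apply/eqP; rewrite eq_le !le_imp (tnormA hT) (tnormC hT y x) imp_app
  (tnormC hT x y) -(tnormA hT) -!le_imp lexx.
Qed.

Lemma imp_trans x y z : T (imp T x y) (imp T y z) <= imp T x z.
Proof.
rewrite le_imp (tnormA hT); apply: le_trans (imp_app y z).
by apply: (tnorm_monol hT); exact: imp_app.
Qed.

Lemma tnorm_lt1 x r : r < x -> exists2 s, s < 1%:i01 & r < T x s.
Proof.
move=> rx; apply: (@tnorm_lt_isup x [set s | s < 1%:i01]).
by rewrite isup_lt tnorm1r.
Qed.

Lemma tnorm_lt_split x y r : r < T x y ->
  exists x' y', [/\ x' < x, y' < y & r < T x' y'].
Proof.
move=> rxy.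
have [y' y'y ry] : exists2 y', y' < y & r < T x y'.
  by apply: (@tnorm_lt_isup x [set s | s < y]); rewrite isup_lt.
have [x' x'x rx] : exists2 x', x' < x & r < T y' x'.
  by apply: (@tnorm_lt_isup y' [set s | s < x]); rewrite isup_lt (tnormC hT).
by exists x', y'; split=> //; rewrite (tnormC hT).
Qed.

Lemma le_of_tnorm_lt1 x y : (forall s, s < 1%:i01 -> T x s <= y) -> x <= y.
Proof.
move=> xy; rewrite leNgt; apply/negP => /tnorm_lt1[s /xy].
by rewrite leNgt => /negPf->.
Qed.

End TNorm.

(** * Weights, forward Cauchy weights and ideals *)

Section Weights.
Context {R : realType} (T : {i01 R} -> {i01 R} -> {i01 R}).
Context (hT : continuous_tnorm T).
Local Notation I := {i01 R}.

Lemma isub_app (X : Type) (phi psi : X -> I) x :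
  T (phi x) (isub T phi psi) <= psi x.
Proof. by rewrite -(le_imp hT); apply: iinf_lb; exists x. Qed.

Lemma le_isub (X : Type) (phi psi : X -> I) (r : I) :
  (forall x, T (phi x) r <= psi x) -> r <= isub T phi psi.
Proof. by move=> h; apply: le_iinf => _ [x _ <-]; rewrite (le_imp hT). Qed.

Lemma isub1 (X : Type) (phi psi : X -> I) :
  isub T phi psi = 1%:i01 <-> forall x, phi x <= psi x.
Proof.
split=> [h x|h].
  by rewrite -[leLHS](tnorm1r hT) -h isub_app.
by apply: i01_ge1; apply: le_isub => x; rewrite (tnorm1r hT).
Qed.

Lemma isub_le1 (X : Type) (phi psi : X -> I) :
  (forall x, phi x <= psi x) -> 1%:i01 <= isub T phi psi.
Proof. by move=> /isub1 ->. Qed.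

Context (X : iorder T).
Implicit Types (x y z a : X) (phi psi lam : X -> I).

Lemma weight_ihom a : weight (fun x : X => ihom x a).
Proof. by move=> x y; exact: ihom_trans. Qed.

Lemma isub_ihom phi a : weight phi -> isub T (fun x => ihom x a) phi = phi a.
Proof.
move=> wphi; apply/eqP; rewrite eq_le le_isub ?andbT => [|x].
  rewrite -[leLHS](tnorm1 hT) -(ihom_refl a).
  exact: (isub_app (fun x => ihom x a)).
by rewrite (tnormC hT); exact: wphi.
Qed.

Lemma le_is_sup phi a x : is_sup phi a -> phi x <= ihom x a.
Proof.
move=> /(_ a); rewrite ihom_refl => /esym/isub1; exact.
Qed.

Lemma is_sup_unique phi a b : iseparated X ->
  is_sup phi a -> is_sup phi b -> a = b.
Proof.
move=> sepX pa pb; apply: sepX.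
  by rewrite pa -pb ihom_refl.
by rewrite pb -pa ihom_refl.
Qed.

Lemma net_weight_weight (J : Type) (leJ : J -> J -> Prop) (u : J -> X) :
  weight (net_weight leJ u).
Proof.
move=> x y; rewrite (tnormC hT); apply: (tnorm_isup_le hT) => _ [i _ <-].
apply: le_trans (isup_ub _); last by exists i.
apply: le_iinf => _ [j ij <-]; apply: le_trans (ihom_trans x y (u j)).
by rewrite (tnormC hT); apply: (tnorm_monol hT); apply: iinf_lb; exists j.
Qed.

Lemma net_weight_tail (J : Type) (leJ : J -> J -> Prop) (u : J -> X) x r :
  r < net_weight leJ u x -> exists i, forall j, leJ i j -> r < ihom x (u j).
Proof.
move=> /lt_isup[_ [i _ <-] ri]; exists i => j ij; apply: lt_le_trans ri _.
by apply: iinf_lb; exists j.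
Qed.

Lemma le_net_weight (J : Type) (leJ : J -> J -> Prop) (u : J -> X) x r i :
  (forall j, leJ i j -> r <= ihom x (u j)) -> r <= net_weight leJ u x.
Proof.
move=> h; apply: le_trans (isup_ub _); last by exists i.
by apply: le_iinf => _ [j ij <-]; exact: h.
Qed.

Lemma forward_cauchy_tail (J : Type) (leJ : J -> J -> Prop) (u : J -> X) r :
  directed leJ -> forward_cauchy leJ u -> r < 1%:i01 ->
  exists i, forall j, leJ i j -> r < net_weight leJ u (u j).
Proof.
move=> dJ <- /lt_isup[_ [i _ <-]] /i01_dense[r' rr' r'i].
exists i => j ij; apply: lt_le_trans rr' _.
apply: (@le_net_weight _ _ _ _ _ j) => l jl.
by apply: le_trans (ltW r'i) _; apply: iinf_lb; exists j, l.
Qed.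

(** The net-free description of forward Cauchy weights: [phi] is inhabited and
    directed up to any precision below 1. *)
Definition is_ideal phi : Prop :=
  (forall r : I, r < 1%:i01 -> exists y, r < phi y) /\
  (forall x1 x2 (r1 r2 s : I), r1 < phi x1 -> r2 < phi x2 -> s < 1%:i01 ->
     exists y, [/\ s < phi y, r1 < ihom x1 y & r2 < ihom x2 y]).

Lemma ideal_of_fcw phi : forward_cauchy_weight phi -> is_ideal phi.
Proof.
move=> [_ [J [leJ [u [dJ cu ->]]]]]; split=> [r r1|x1 x2 r1 r2 s h1 h2 s1].
  have [i hi] := forward_cauchy_tail dJ cu r1; exists (u i).
  by apply: hi; exact: (directed_refl dJ).
have [i0 hi0] := forward_cauchy_tail dJ cu s1.
have [i1 hi1] := net_weight_tail h1.
have [i2 hi2] := net_weight_tail h2.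
have [j [i1j i2j]] := directed_ub dJ i1 i2.
have [l [jl i0l]] := directed_ub dJ j i0.
exists (u l); split; [exact: hi0 | apply: hi1 | apply: hi2].
  exact: (directed_trans dJ i1j jl).
exact: (directed_trans dJ i2j jl).
Qed.

(** Conversely an ideal is generated by the net of its points [(x, r)] with
    [r < phi x], thought of as the formal multiples of [x] by [r]: such a point is
    below [(y, s)] when [r <= T s (ihom x y)].  That relation, unlike closeness
    of points, is transitive. *)
Lemma fcw_of_ideal phi : weight phi -> is_ideal phi -> forward_cauchy_weight phi.
Proof.
move=> wphi [phi1 phidir]; split=> //.
pose J := {p : X * I | p.2 < phi p.1}.
pose leJ (p q : J) := (sval p).2 <= T (sval q).2 (ihom (sval p).1 (sval q).1).
pose u (p : J) : X := (sval p).1.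
have jge (p q : J) : leJ p q -> (sval p).2 <= (sval q).2.
  by move=> h; apply: le_trans h _; exact: (tnorm_le_l hT).
have jhom (p q : J) : leJ p q -> (sval p).2 <= ihom (u p) (u q).
  by move=> h; apply: le_trans h _; exact: (tnorm_le_r hT).
have jub (p q : J) s : s < 1%:i01 ->
    exists k : J, [/\ leJ p k, leJ q k & s < (sval k).2].
  case: p q => [[x1 r1] /= h1] [[x2 r2] /= h2] s1.
  have [r1' hr1 h1'] := i01_dense h1; have [r2' hr2 h2'] := i01_dense h2.
  have [s1' s1'1 hs1] := tnorm_lt1 hT hr1; have [s2' s2'1 hs2] := tnorm_lt1 hT hr2.
  have [s' [s'1 ss' s1s' s2s']] :
      exists s', [/\ s' < 1%:i01, s < s', s1' <= s' & s2' <= s'].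
    have [z sz z1] := i01_dense s1; exists (Order.max (Order.max s1' s2') z).
    by rewrite !gt_max !lt_max !le_max s1'1 s2'1 z1 sz !lexx !orbT.
  have [y [hy h1y h2y]] := phidir _ _ _ _ _ h1' h2' s'1.
  exists (exist _ (y, s') hy); rewrite /leJ /=; split=> //.
    apply: le_trans (ltW hs1) _; rewrite (tnormC hT).
    by apply: (tnorm_mono hT) => //; exact: ltW.
  apply: le_trans (ltW hs2) _; rewrite (tnormC hT).
  by apply: (tnorm_mono hT) => //; exact: ltW.
have jlt r : r < 1%:i01 -> exists p : J, r < (sval p).2.
  move=> /phi1[y] /i01_dense[s rs sy]; by exists (exist _ (y, s) sy).
exists J, leJ, u; split.
- split=> [|p|p q k pq qk|p q].
  + by have [p _] := jlt _ i01_lt01; exists.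
  + by rewrite /leJ ihom_refl (tnorm1r hT).
  + rewrite /leJ in pq qk *; apply: le_trans pq _.
    apply: le_trans (tnorm_monol hT _ qk) _.
    rewrite -(tnormA hT); apply: (tnorm_monor hT).
    exact: ihom_trans.
  + by have [k [pk qk _]] := jub p q _ i01_lt01; exists k.
- apply: i01_ge1; apply: le_of_lt => r /jlt[p rp].
  apply: le_trans (isup_ub _); last by exists p.
  apply: le_iinf => _ [q [k [pq qk ->]]].
  by apply: le_trans (ltW rp) _; apply: le_trans (jge _ _ pq) _; exact: jhom.
- apply/funext => x; apply/eqP; rewrite eq_le; apply/andP; split.
    apply: le_of_lt => r rx; pose p : J := exist _ (x, r) rx.
    by apply: (@le_net_weight _ _ _ _ _ p) => q pq; exact: (jhom p).
  apply: isup_le => _ [p _ <-]; apply: (le_of_tnorm_lt1 hT) => s s1.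
  have [k [pk _ sk]] := jub p p s s1.
  apply: le_trans (wphi x (u k)); rewrite (tnormC hT); apply: (tnorm_mono hT).
    by apply: ltW; apply: lt_trans sk _; case: (k).
  by apply: iinf_lb; exists k.
Qed.

Lemma net_weight_mono (J : Type) (leJ : J -> J -> Prop) (u : J -> X) :
  directed leJ -> (forall i j, leJ i j -> ihom (u i) (u j) = 1%:i01) ->
  net_weight leJ u = fun x => isup (range (fun j => ihom x (u j))).
Proof.
move=> dJ mu; apply/funext => x; congr isup; congr (image _); apply/funext => i.
apply/eqP; rewrite eq_le; apply/andP; split.
  by apply: iinf_lb; exists i => //; exact: (directed_refl dJ).
apply: le_iinf => _ [j ij <-]; apply: le_trans (ihom_trans x (u i) (u j)).
by rewrite mu// (tnorm1 hT).
Qed.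

Lemma fcw_mono_net (J : Type) (leJ : J -> J -> Prop) (u : J -> X) :
  directed leJ -> (forall i j, leJ i j -> ihom (u i) (u j) = 1%:i01) ->
  forward_cauchy_weight (fun x => isup (range (fun j => ihom x (u j)))).
Proof.
move=> dJ mu; rewrite -(net_weight_mono dJ mu); split; first exact: net_weight_weight.
exists J, leJ, u; split=> //; apply: i01_ge1; have [i] := directed_inhabited dJ.
apply: le_trans (isup_ub _); last by exists i.
by apply: le_iinf => _ [j [l [_ jl ->]]]; rewrite mu.
Qed.

Lemma isub_isup_ihom (J : Type) (u : J -> X) phi : weight phi ->
  isub T (fun x => isup (range (fun j => ihom x (u j)))) phi =
  iinf (range (phi \o u)).
Proof.
move=> wphi; apply/eqP; rewrite eq_le; apply/andP; split.
  apply: le_iinf => _ [j _ <-] /=; rewrite -[leLHS](tnorm1 hT).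
  apply: le_trans (isub_app _ _ (u j)); apply: (tnorm_monol hT).
  by rewrite -(ihom_refl (u j)); apply: isup_ub; exists j.
apply: le_isub => x; rewrite (tnormC hT); apply: (tnorm_isup_le hT) => _ [j _ <-].
apply: le_trans (wphi x (u j)); apply: (tnorm_monol hT).
by apply: iinf_lb; exists j.
Qed.

End Weights.

(** * The Scott approach structure *)

Section Scott.
Context {R : realType} (T : {i01 R} -> {i01 R} -> {i01 R}).
Context (hT : continuous_tnorm T).
Local Notation I := {i01 R}.
Context (X : iorder T).
Implicit Types (x y z a : X) (phi psi lam : X -> I) (A B : set X).

(** Only one of the two inequalities defining Scott closedness has content. *)
Lemma scott_closedP phi : weight phi ->
  (forall lam a, forward_cauchy_weight lam -> is_sup lam a ->
     isub T lam phi <= phi a) ->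
  scott_closed phi.
Proof.
move=> wphi h; split=> // lam a flam alam; apply/eqP.
rewrite eq_le h//= le_isub// => x.
rewrite (tnormC hT); apply: le_trans (wphi x a).
by apply: (tnorm_monor hT); exact: le_is_sup.
Qed.

Lemma scott_closed_ihom a : scott_closed (fun x : X => ihom x a).
Proof. by split=> [|lam b _ ->//]; exact: weight_ihom. Qed.

Lemma scott_closed_imp (r : I) phi :
  scott_closed phi -> scott_closed (fun x => imp T r (phi x)).
Proof.
move=> [wphi sphi]; apply: scott_closedP => [x y|lam a flam alam].
  rewrite (le_imp hT) (tnormA hT); apply: le_trans (wphi x y).
  by apply: (tnorm_monol hT); exact: imp_app.
rewrite (le_imp hT) -(sphi lam)//; apply: (le_isub hT) => x.
rewrite (tnormA hT) (tnormC hT _ r) -(tnormA hT) -(le_imp hT).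
exact: (isub_app hT lam (fun x => imp T r (phi x))).
Qed.

Lemma scott_closed0 : scott_closed (fun _ : X => 0%:i01 : I).
Proof.
apply: scott_closedP => [x y|lam a /ideal_of_fcw[lam1 _] _].
  by rewrite (tnorm0 hT).
apply: (le_of_tnorm_lt1 hT) => s /lam1[x sx]; rewrite (tnormC hT).
apply: le_trans (isub_app hT lam (fun=> 0%:i01) x).
by apply: (tnorm_monol hT); exact: ltW.
Qed.

(** The tails of a forward Cauchy net are nearly in the ideal it generates, and
    one of two functions whose maximum is large along the net is large
    cofinally. *)
Lemma scott_closed_max phi psi : scott_closed phi -> scott_closed psi ->
  scott_closed (fun x => Order.max (phi x) (psi x)).
Proof.
move=> [wphi sphi] [wpsi spsi]; apply: scott_closedP => [x y|lam a flam alam].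
  rewrite (tnormC hT) le_max /Order.max; case: ifP => _.
    by rewrite (tnormC hT) wpsi orbT.
  by rewrite (tnormC hT) wphi.
rewrite -(sphi _ _ flam alam) -(spsi _ _ flam alam).
have [_ [J [leJ [u [dJ cu ->]]]]] := flam.
set t := isub _ _ (fun x => Order.max _ _).
apply: (le_of_tnorm_lt1 hT) => s s1.
have [i hi] := forward_cauchy_tail dJ cu s1.
have cofinal (chi : X -> I) : weight chi ->
    (forall k, exists2 j, leJ k j & T t s <= chi (u j)) ->
    T t s <= isub T (net_weight leJ u) chi.
  move=> wchi cof; apply: (le_isub hT) => x; rewrite (tnormC hT).
  apply: (tnorm_isup_le hT) => _ [k _ <-]; have [j kj tj] := cof k.
  apply: le_trans (wchi x (u j)); apply: (tnorm_mono hT) => //.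
  by apply: iinf_lb; exists j.
have large j : leJ i j -> (T t s <= phi (u j)) || (T t s <= psi (u j)).
  move=> ij; rewrite -le_max (tnormC hT).
  apply: le_trans
    (isub_app hT (net_weight leJ u) (fun x => Order.max (phi x) (psi x)) (u j)).
  by apply: (tnorm_monol hT); apply: ltW; exact: hi.
rewrite le_max; apply/orP.
have [cofphi|] := pselect (forall k, exists2 j, leJ k j & T t s <= phi (u j)).
  by left; exact: cofinal.
move=> /existsNP[k0 k0phi]; right; apply: cofinal => // k.
have [k1 [k0k1 kk1]] := directed_ub dJ k0 k.
have [j [k1j ij]] := directed_ub dJ k1 i.
exists j; first exact: (directed_trans dJ kk1 k1j).
have /orP[phij|//] := large j ij; exfalso; apply: k0phi; exists j => //.
exact: (directed_trans dJ k0k1 k1j).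
Qed.

Lemma scott_dist_le phi x A : scott_closed phi ->
  (forall a, A a -> phi a = 1%:i01) -> scott_dist x A <= phi x.
Proof. by move=> sphi phiA; apply: iinf_lb; exists phi. Qed.

Lemma le_scott_dist x A (r : I) :
  (forall phi, scott_closed phi -> (forall a, A a -> phi a = 1%:i01) -> r <= phi x) ->
  r <= scott_dist x A.
Proof. by move=> h; apply: le_iinf => _ [phi [sphi phiA] <-]; exact: h. Qed.

Lemma ihom_le_scott_dist x a A : A a -> ihom x a <= scott_dist x A.
Proof.
move=> Aa; apply: le_scott_dist => phi [wphi _] phiA.
by rewrite -[leLHS](tnorm1 hT) -(phiA _ Aa); exact: wphi.
Qed.

Lemma scott_closed_dist phi x A : scott_closed phi ->
  T (scott_dist x A) (iinf [set phi a | a in A]) <= phi x.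
Proof.
move=> sphi; rewrite (tnormC hT) -(le_imp hT).
apply: scott_dist_le (scott_closed_imp _ sphi) _ => a Aa.
by apply: (imp1 hT); apply: iinf_lb; exists a.
Qed.

Lemma scott_dist_mono x A B : A `<=` B -> scott_dist x A <= scott_dist x B.
Proof.
move=> AB; apply: le_scott_dist => phi sphi phiB; apply: scott_dist_le => // a /AB.
exact: phiB.
Qed.

Theorem scott_approach : approach T (@scott_dist R T X).
Proof.
split=> [x|x|x A B|x A B].
- apply: i01_ge1; apply: le_scott_dist => phi _ phix; by rewrite phix.
- by apply: i01_le0; exact: scott_dist_le scott_closed0 _.
- apply/eqP; rewrite eq_le; apply/andP; split; last first.
    by rewrite ge_max; apply/andP; split; apply: scott_dist_mono => a; [left | right].
  rewrite leNgt gt_max; apply/negP => /andP[] /iinf_lt[_ [phi [sphi phiA] <-] hphi].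
  move=> /iinf_lt[_ [psi [spsi psiB] <-] hpsi].
  have : scott_dist x (A `|` B) <= Order.max (phi x) (psi x).
    apply: (scott_dist_le x (scott_closed_max sphi spsi)) => a [/phiA ->|/psiB ->].
      by apply/max_idPl; exact: i01_le1.
    by apply/max_idPr; exact: i01_le1.
  by rewrite leNgt gt_max hphi hpsi.
- apply: le_scott_dist => phi sphi phiA.
  rewrite (tnormC hT); apply: le_trans (scott_closed_dist x B sphi).
  apply: (tnorm_monor hT); apply: le_iinf => _ [b Bb <-].
  apply: le_trans (scott_dist_le b sphi phiA).
  by apply: iinf_lb; exists b.
Qed.

End Scott.

(** * Closed functions on approach spaces *)

Section ClosedMaps.
Context {R : realType} (T : {i01 R} -> {i01 R} -> {i01 R}).
Context (hT : continuous_tnorm T).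
Local Notation I := {i01 R}.

(** These are the continuous maps to the interval with the approach structure
    [inf_dist] introduced below. *)
Definition closed_map (X : Type) (dX : X -> set X -> I) (c : X -> I) : Prop :=
  forall x A, T (dX x A) (iinf [set c a | a in A]) <= c x.

Definition vanishing_closed_map (X : Type) (dX : X -> set X -> I) (p : X)
    (c : X -> I) : Prop :=
  closed_map dX c /\ c p = 0%:i01.

Lemma closed_map_comp (X Y : Type) (dX : X -> set X -> I) (dY : Y -> set Y -> I)
    (f : X -> Y) (c : Y -> I) :
  approach_continuous dX dY f -> closed_map dY c -> closed_map dX (c \o f).
Proof.
move=> cf cc x A; apply: le_trans (cc (f x) (f @` A)).
apply: (tnorm_mono hT) => //; apply: le_iinf => _ [_ [a Aa <-] <-].
by apply: iinf_lb; exists a.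
Qed.

Context (X : Type) (dX : X -> set X -> I) (hX : approach T dX).
Implicit Types (x : X) (A B : set X) (c : X -> I).

Lemma approach_mono x A B : A `<=` B -> dX x A <= dX x B.
Proof.
move=> AB; have <- : A `|` B = B by exact/setUidPr.
by rewrite (approachU hX) le_max lexx.
Qed.

Lemma closed_map_dist A : closed_map dX (fun x => dX x A).
Proof. by move=> x B; rewrite (tnormC hT); exact: (approachT hX). Qed.

Lemma closed_map0 : closed_map dX (fun=> 0%:i01).
Proof.
move=> x A; have [->|/set0P[a Aa]] := eqVneq A set0.
  by rewrite (approach0 hX) (tnorm0 hT).
rewrite -[leRHS](tnorm0r hT (dX x A)); apply: (tnorm_monor hT).
by apply: iinf_lb; exists a.
Qed.

Lemma closed_map_max c c' : closed_map dX c -> closed_map dX c' ->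
  closed_map dX (fun x => Order.max (c x) (c' x)).
Proof.
move=> cc cc' x A.
pose B := A `&` [set a | c' a <= c a]; pose B' := A `&` [set a | c a <= c' a].
have -> : A = B `|` B'.
  rewrite -setIUr; apply/esym/setIidPl => a _ /=; exact: orP (le_total _ _).
rewrite (approachU hX) [X in T X _]/Order.max le_max; case: ifP => _.
  apply/orP; right; apply: le_trans (cc' x B'); apply: (tnorm_monor hT).
  apply: le_iinf => _ [a B'a <-]; apply: le_trans (iinf_lb _) _; first by exists a; [right|].
  by rewrite /= ge_max lexx andbT; case: B'a.
apply/orP; left; apply: le_trans (cc x B); apply: (tnorm_monor hT).
apply: le_iinf => _ [a Ba <-]; apply: le_trans (iinf_lb _) _; first by exists a; [left|].
by rewrite /= ge_max lexx; case: Ba.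
Qed.

Lemma closed_map_tnorm (r : I) c : closed_map dX c -> closed_map dX (fun x => T r (c x)).
Proof.
move=> cc x A; have [->|A0] := eqVneq A set0.
  by rewrite (approach0 hX) (tnorm0 hT) i01_ge0.
apply: le_trans (tnorm_monor hT _ (cc x A)).
rewrite (tnormA hT) (tnormC hT r) -(tnormA hT); apply: (tnorm_monor hT).
apply: (le_tnorm_iinf hT) => [|_ [a Aa <-]].
  by have /set0P[a Aa] := A0; exists (c a), a.
by apply: iinf_lb; exists a.
Qed.

End ClosedMaps.

(** * Interpolation in domains *)

Section WayBelow.
Context {R : realType} (T : {i01 R} -> {i01 R} -> {i01 R}).
Context (hT : continuous_tnorm T).
Local Notation I := {i01 R}.
Context (Z : iorder T) (sepZ : iseparated Z) (s : fcw Z -> Z) (d : Z -> fcw Z).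
Context (hs : left_adjoint (@fcw_hom R T Z) (@ihom R T Z) s (@yoneda R T Z)).
Context (hd : left_adjoint (@ihom R T Z) (@fcw_hom R T Z) d s).
Implicit Types (x y z a : Z).

(** The degree to which [z] is way below [x] is read off the left adjoint [d] of
    the supremum. *)
Definition way_below z x : I := sval (d x) z.
Local Notation w := way_below.

Lemma fcw_sup (lam : fcw Z) : is_sup (sval lam) (s lam).
Proof. by move=> y; rewrite hs. Qed.

Lemma is_sup_ihom a : is_sup (fun x : Z => ihom x a) a.
Proof. by move=> y; rewrite (isub_ihom hT)//; exact: weight_ihom. Qed.

Lemma way_below_ihom z x : w z x <= ihom z x.
Proof.
have := hd x (yoneda x).
rewrite (is_sup_unique sepZ (fcw_sup (yoneda x)) (is_sup_ihom x)).
by rewrite ihom_refl => /(isub1 hT)/(_ z).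
Qed.

Lemma ihom_sup_way_below x : ihom x (s (d x)) = 1%:i01.
Proof. by rewrite -hd; apply/(isub1 hT). Qed.

Lemma way_below_trans z x x' : T (w z x) (ihom x x') <= w z x'.
Proof.
apply: le_trans (isub_app hT (sval (d x)) (sval (d x')) z).
apply: (tnorm_monor hT); rewrite -[leRHS]/(fcw_hom (d x) (d x')) hd.
rewrite -[leLHS](tnorm1 hT) -(ihom_sup_way_below x'); exact: ihom_trans.
Qed.

Lemma way_below_weight x : weight (w^~ x).
Proof. by have [] := svalP (d x). Qed.

(** The weight obtained by composing [lam] with the way-below weights is again
    an ideal, so it has a supremum; the latter lies above [a], and the
    adjunction for [d] turns this into the stated interpolation property. *)
Lemma way_below_sup lam a z : forward_cauchy_weight lam -> is_sup lam a ->
  w z a <= isup (range (fun x => T (lam x) (w z x))).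
Proof.
move=> flam alam; pose kappa z' := isup (range (fun x => T (lam x) (w z' x))).
have le_kappa x z' : T (lam x) (w z' x) <= kappa z' by apply: isup_ub; exists x.
have kappa_weight : weight kappa.
  move=> x y; rewrite (tnormC hT); apply: (tnorm_isup_le hT) => _ [x' _ <-].
  apply: le_trans (le_kappa x' x); rewrite (tnormC hT) -(tnormA hT).
  by apply: (tnorm_monor hT); exact: way_below_weight.
have [lam1 lamdir] := ideal_of_fcw flam.
have wideal x : is_ideal (w^~ x) by apply: ideal_of_fcw; exact: (svalP (d x)).
have kappa_ideal : is_ideal kappa.
  have kappa_gt (e : I) : e < 1%:i01 -> exists2 e', e' < 1%:i01 &
      forall x y, e' < lam x -> e' < w y x -> e < kappa y.
    rewrite -[X in _ < X](tnorm1 hT) => /(tnorm_lt_split hT)[p [q [p1 q1 epq]]].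
    exists (Order.max p q); first by rewrite gt_max p1 q1.
    move=> x y; rewrite !gt_max => /andP[px qx] /andP[py qy].
    apply: lt_le_trans epq _; apply: le_trans (le_kappa x y).
    by apply: (tnorm_mono hT); exact: ltW.
  split=> [r /kappa_gt[e' e'1 he']|y1 y2 r1 r2 e].
    have [x ex] := lam1 _ e'1; have [y ey] := (wideal x).1 _ e'1.
    by exists y; exact: he' ex ey.
  move=> /lt_isup[_ [x1 _ <-]] /(tnorm_lt_split hT)[p1 [q1 [hp1 hq1 r1pq]]].
  move=> /lt_isup[_ [x2 _ <-]] /(tnorm_lt_split hT)[p2 [q2 [hp2 hq2 r2pq]]].
  move=> /kappa_gt[e' e'1 he'].
  have [x [ex x1x x2x]] := lamdir _ _ _ _ _ hp1 hp2 e'1.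
  have wx y' x' (p q r : I) : r < T p q -> p < ihom x' x -> q < w y' x' -> r < w y' x.
    move=> rpq px qy; apply: lt_le_trans rpq _.
    apply: le_trans (way_below_trans y' x' x); rewrite (tnormC hT).
    by apply: (tnorm_mono hT); exact: ltW.
  have [y [ey y1y y2y]] :=
    (wideal x).2 _ _ _ _ _ (wx _ _ _ _ _ r1pq x1x hq1) (wx _ _ _ _ _ r2pq x2x hq2) e'1.
  by exists y; split=> //; exact: he' ex ey.
pose k : fcw Z := exist _ kappa (fcw_of_ideal hT kappa_weight kappa_ideal).
have dk : fcw_hom (d a) k = ihom a (s k) by rewrite hd.
have ak1 : ihom a (s k) = 1%:i01.
  rewrite alam; apply/(isub1 hT) => x; rewrite -hd.
  by apply: (le_isub hT) => z'; rewrite (tnormC hT); exact: le_kappa.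
by apply: ((isub1 hT (sval (d a)) kappa).1 _ z); rewrite -ak1 -dk.
Qed.

End WayBelow.

(** * Extension of maps under an involutive negation *)

Section Involutive.
Context {R : realType} (T : {i01 R} -> {i01 R} -> {i01 R}).
Context (hT : continuous_tnorm T).
Local Notation I := {i01 R}.
Local Notation neg := (tnorm_neg T).
Context (negK : forall x : I, neg (neg x) = x).
Context (nilpotent : forall r : I, r < 1%:i01 -> exists n, tpow T r n = 0%:i01).
Implicit Types (x y r : I).

Lemma le_neg x y : (y <= neg x) = (T x y <= 0%:i01).
Proof. exact: (le_imp hT). Qed.

Lemma tnorm_neg_eq0 x : T x (neg x) = 0%:i01.
Proof. by apply: i01_le0; rewrite -le_neg. Qed.

Lemma neg_tnorm x y : neg (T x y) = imp T x (neg y).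
Proof. exact: (imp_curry hT). Qed.

Lemma neg_anti x y : x <= y -> neg y <= neg x.
Proof. by move=> xy; apply: (imp_mono hT). Qed.

Lemma neg_lt x y : x < y -> neg y < neg x.
Proof.
move=> xy; rewrite ltNge; apply/negP => /neg_anti; rewrite !negK.
by rewrite leNgt xy.
Qed.

Lemma imp_neg x y : imp T x y = neg (T x (neg y)).
Proof. by rewrite neg_tnorm negK. Qed.

Lemma neg0 : neg 0%:i01 = 1%:i01. Proof. by rewrite /tnorm_neg (imp1 hT). Qed.

(** The powers of some [r < 1] cut the interval into finitely many layers, and
    [psi] is the maximum of the distances to the corresponding upper level sets
    of [c], truncated at the layers.  At [y0] this exceeds [c y0] at most by
    residuation by [r], which is harmless for [r] close to 1. *)
Lemma closed_map_extend (X : Type) (dX : X -> set X -> I) (Y : set X)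
    (c : Y -> I) (y0 : Y) (t : I) :
  approach T dX -> closed_map T (subspace_dist dX (Y:=Y)) c -> c y0 < t ->
  exists psi : X -> I, [/\ closed_map T dX psi,
    forall y : Y, c y <= psi (set_val y) & psi (set_val y0) <= t].
Proof.
move=> hX cc ct.
have [r r1 rt] : exists2 r, r < 1%:i01 & imp T r (c y0) <= t.
  have [r r1 rt] := tnorm_lt1 hT (neg_lt ct); exists r => //.
  rewrite imp_neg -[leRHS]negK; apply: neg_anti.
  by rewrite (tnormC hT) ltW.
have [n rn0] := nilpotent r1.
have [psi [cpsi psit psic]] : exists psi : X -> I, [/\ closed_map T dX psi,
    psi (set_val y0) <= t &
    forall y : Y, tpow T r n < c y -> c y <= psi (set_val y)]; last first.
  exists psi; split=> // y; move: (psic y); rewrite rn0.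
  have [/i01_le0 -> _|_] := leP (c y) 0%:i01; [exact: i01_ge0|exact].
elim: n {rn0} => [|n [psi [cpsi psit psic]]].
  exists (fun=> 0%:i01); split; [exact: closed_map0 | exact: i01_ge0 |].
  by move=> y y1; have := i01_le1 (c y); rewrite leNgt y1.
set tn := tpow T r n in psic.
pose A := [set y : Y | T r tn < c y].
exists (fun p : X => Order.max (psi p) (T tn (dX p (set_val @` A)))); split.
- apply: (closed_map_max hT hX) => //.
  by apply: (closed_map_tnorm hT hX); exact: (closed_map_dist hT hX).
- rewrite ge_max psit /=; apply: le_trans rt.
  rewrite (le_imp hT); apply: le_trans (cc y0 A).
  rewrite (tnormA hT) (tnormC hT); apply: (tnorm_monor hT).
  by apply: le_iinf => _ [y Ay <-]; exact: ltW.
- move=> y ry; rewrite le_max.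
  have [/psic ->//|ytn] := ltP tn (c y).
  apply/orP; right; apply: le_trans ytn _.
  rewrite -[leLHS](tnorm1r hT); apply: (tnorm_monor hT).
  rewrite -(approach1 hX (set_val y)); apply: (approach_mono hX) => _ ->.
  by exists y.
Qed.

Section Injective.
Context (Z : iorder T) (comZ : complete_lattice Z).
Context (s : fcw Z -> Z) (d : Z -> fcw Z).
Context (hs : left_adjoint (@fcw_hom R T Z) (@ihom R T Z) s (@yoneda R T Z)).
Context (hd : left_adjoint (@ihom R T Z) (@fcw_hom R T Z) d s).
Local Notation w := (way_below d).

(** The interpolation property says that way-below degrees are Scott open, and an
    involutive negation turns open into closed. *)
Lemma scott_closed_way_below z : scott_closed (fun x : Z => neg (w z x)).
Proof.
apply: (scott_closedP hT) => [x y|lam a flam alam].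
  rewrite le_neg (tnormC hT (neg _)) (tnormA hT) -le_neg.
  by apply: neg_anti; exact: (way_below_trans hT hd).
rewrite le_neg (tnormC hT).
apply: le_trans (tnorm_monor hT _ (way_below_sup hT hd z flam alam)) _.
apply: (tnorm_isup_le hT) => _ [x _ <-].
rewrite (tnormA hT) (tnormC hT) -le_neg (tnormC hT).
exact: (isub_app hT lam (fun x : Z => neg (w z x))).
Qed.

Context (X : Type) (dX : X -> set X -> I) (hX : approach T dX).
Context (Y : set X) (f : Y -> Z).
Context (cf : approach_continuous (subspace_dist dX (Y:=Y)) (@scott_dist R T Z) f).

(** The infimum in [Z] of the values of [f], weighted by the open function
    [neg c], is the supremum of the weight of its lower bounds. *)
Lemma weighted_infimum (c : X -> I) : exists m : Z, forall z,
  ihom z m = iinf (range (fun y : Y => imp T (neg (c (set_val y))) (ihom z (f y)))).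
Proof.
pose phi z := iinf (range (fun y : Y => imp T (neg (c (set_val y))) (ihom z (f y)))).
have wphi : weight phi.
  move=> z z'; apply: le_iinf => _ [y _ <-]; rewrite (le_imp hT) (tnormA hT).
  apply: le_trans (ihom_trans z z' (f y)).
  by apply: (tnorm_monol hT); rewrite -(le_imp hT); apply: iinf_lb; exists y.
have [m msup] := comZ.2 phi wphi; exists m => z.
apply/eqP; rewrite eq_le; apply/andP; split; last first.
  exact: le_is_sup msup.
apply: le_iinf => _ [y _ <-]; rewrite (le_imp hT) (tnormC hT).
apply: le_trans (ihom_trans z m (f y)); rewrite (tnormC hT).
apply: (tnorm_monol hT); rewrite msup.
apply: (le_isub hT) => z'; rewrite (tnormC hT) -(le_imp hT).
by apply: iinf_lb; exists y.
Qed.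

(** The value of the extension at [p] is a lower limit of [f] at [p]: the supremum
    of the weighted infima of [f] over the open functions with value 1 at [p],
    encoded by their negations, which vanish at [p].  These infima form a
    monotone net, so Scott closed weights commute with that supremum, which gives
    continuity.  That the extension agrees with [f] on [Y] follows from
    approximating [f y] by its way-below weight and extending the negated degrees
    by [closed_map_extend]. *)
Theorem extension_exists : exists g : X -> Z,
  approach_continuous dX (@scott_dist R T Z) g /\ forall y : Y, g (set_val y) = f y.
Proof.
have [m hm] := choice weighted_infimum.
have le_m z c (r : I) : (forall y : Y, T r (neg (c (set_val y))) <= ihom z (f y)) ->
    r <= ihom z (m c).
  move=> h; rewrite hm; apply: le_iinf => _ [y _ <-].
  by rewrite (le_imp hT) (tnormC hT).
have m_le c (y : Y) : T (neg (c (set_val y))) (ihom (m c) (m c)) <= ihom (m c) (f y).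
  by rewrite [in leLHS]hm -(le_imp hT); apply: iinf_lb; exists y.
pose J p := {c : X -> I | vanishing_closed_map T dX p c}.
pose leJ p (c c' : J p) := forall x : X, sval c x <= sval c' x.
pose u p (c : J p) := m (sval c).
have dJ p : directed (leJ p).
  split=> [|c x//|c1 c2 c3 h12 h23 x|c1 c2].
  - by exists; exists (fun=> 0%:i01); split=> //; exact: closed_map0.
  - exact: le_trans (h12 x) (h23 x).
  - have [[cc1 c1p] [cc2 c2p]] := (svalP c1, svalP c2).
    have hmax :
        vanishing_closed_map T dX p (fun x : X => Order.max (sval c1 x) (sval c2 x)).
      by split; [exact: (closed_map_max hT hX) | rewrite c1p c2p maxxx].
    by exists (exist _ _ hmax); split=> x /=; rewrite le_max lexx ?orbT.
have mono p (c c' : J p) : leJ p c c' -> ihom (u p c) (u p c') = 1%:i01.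
  move=> cc'; apply: i01_ge1; apply: le_m => y; rewrite (tnorm1 hT).
  apply: le_trans (m_le _ y); rewrite ihom_refl (tnorm1r hT).
  by apply: neg_anti; exact: cc'.
pose lam p : fcw Z := exist _ _ (fcw_mono_net hT (dJ p) (mono p)).
have sup_lam p : is_sup (sval (lam p)) (s (lam p)) by exact: fcw_sup.
have le_g p (c : J p) z : ihom z (u p c) <= ihom z (s (lam p)).
  apply: le_trans (le_is_sup hT z (sup_lam p)).
  by apply: isup_ub; exists c.
(* multiplying a closed function by the negation of its value at p puts it in
   the index set of p *)
have cut p c : closed_map T dX c ->
    vanishing_closed_map T dX p (fun x : X => T (neg (c p)) (c x)).
  move=> cc; split; first exact: (closed_map_tnorm hT hX).
  by rewrite (tnormC hT) tnorm_neg_eq0.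
exists (fun p => s (lam p)); split=> [p A|y].
  apply: le_scott_dist => phi sphi phiA; have [wphi _] := sphi.
  rewrite -(sphi.2 _ _ (svalP (lam p)) (sup_lam p)).
  rewrite (isub_isup_ihom hT)//; apply: le_iinf => _ [[c [cc cp]] _ <-] /=.
  rewrite /u /= -[leRHS]negK le_neg (tnormC hT) -[leRHS]cp.
  apply: le_trans (cc p A); apply: (tnorm_monor hT).
  apply: le_iinf => _ [q Aq <-]; rewrite -[leRHS]negK; apply: neg_anti.
  have cq := cut q c cc.
  have phi1 : phi (m (fun x : X => T (neg (c q)) (c x))) = 1%:i01.
    apply: i01_ge1; rewrite -(phiA (s (lam q))); last by exists q.
    rewrite -(sphi.2 _ _ (svalP (lam q)) (sup_lam q)) (isub_isup_ihom hT)//.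
    by apply: iinf_lb; exists (exist _ _ cq).
  apply: le_trans (wphi (m c) (m (fun x : X => T (neg (c q)) (c x)))).
  rewrite phi1 (tnorm1 hT); apply: le_m => y.
  apply: le_trans (m_le c y); rewrite ihom_refl (tnorm1r hT).
  by rewrite neg_tnorm (imp_app hT).
have sepZ := comZ.1; apply: (sepZ).
  rewrite (sup_lam (set_val y)); apply/(isub1 hT) => z.
  apply: isup_le => _ [[c [cc cy]] _ <-]; rewrite /u /=.
  apply: le_trans (ihom_trans z (m c) (f y)); rewrite (tnormC hT).
  rewrite -[leLHS](tnorm1r hT); apply: (tnorm_monor hT).
  by have := m_le c y; rewrite cy neg0 (tnorm1 hT) ihom_refl.
apply: i01_ge1; have := ihom_trans (f y) (s (d (f y))) (s (lam (set_val y))).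
rewrite (ihom_sup_way_below hT hd) (tnorm1r hT); apply: le_trans.
rewrite (fcw_sup hs); apply: (isub_le1 hT) => z.
rewrite -[leLHS]negK -[leRHS]negK; apply: neg_anti; apply: ge_of_gt => t ct.
have cw : closed_map T (subspace_dist dX (Y:=Y)) (fun b : Y => neg (w z (f b))).
  apply: (closed_map_comp hT cf (c := fun x : Z => neg (w z x))) => x A.
  exact: (scott_closed_dist hT x A (scott_closed_way_below z)).
have [psi [cpsi psiY psit]] := closed_map_extend hX cw ct.
have cy := cut (set_val y) psi cpsi.
rewrite -[leRHS]negK; apply: neg_anti.
apply: le_trans (neg_anti psit) _.
apply: le_trans (le_g _ (exist _ _ cy) z).
apply: le_m => y'; rewrite neg_tnorm.
apply: le_trans (imp_app hT _ _) _.
apply: le_trans (way_below_ihom hT sepZ hs hd z (f y')).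
by rewrite -[leRHS]negK; apply: neg_anti; exact: psiY.
Qed.
End Injective.
End Involutive.

(** * The interval as a continuous lattice *)

Section IntervalLattice.
Context {R : realType} (T : {i01 R} -> {i01 R} -> {i01 R}).
Context (hT : continuous_tnorm T).
Local Notation I := {i01 R}.
Implicit Types (x y z a b r t : I) (A B : set I).

Lemma interval_hom_refl x : imp T x x = 1%:i01.
Proof. exact: imp1. Qed.

Lemma interval_hom_trans x y z : T (imp T y z) (imp T x y) <= imp T x z.
Proof. by rewrite (tnormC hT); exact: imp_trans. Qed.

Definition interval_order : iorder T := IOrder interval_hom_refl interval_hom_trans.

Definition interval_sup (phi : I -> I) : I := isup (range (fun x => T (phi x) x)).

Lemma interval_is_sup (phi : I -> I) :
  is_sup (X := interval_order) phi (interval_sup phi).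
Proof.
move=> y /=; apply/eqP; rewrite eq_le; apply/andP; split.
  apply: (le_isub hT) => x; rewrite (le_imp hT) (tnormA hT).
  apply: le_trans (imp_app hT (interval_sup phi) y).
  by apply: (tnorm_monol hT); rewrite (tnormC hT); apply: isup_ub; exists x.
rewrite (le_imp hT) (tnormC hT); apply: (tnorm_isup_le hT) => _ [x _ <-].
rewrite (tnormA hT) (tnormC hT) -(le_imp hT) (tnormC hT).
exact: (isub_app hT phi (fun x => imp T x y)).
Qed.

Lemma interval_separated : iseparated interval_order.
Proof.
move=> x y /eqP; rewrite (imp_eq1 hT) => xy /eqP; rewrite (imp_eq1 hT) => yx.
by apply/eqP; rewrite eq_le; apply/andP.
Qed.

Lemma interval_complete : complete_lattice interval_order.
Proof.
split; first exact: interval_separated.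
by move=> phi _; exists (interval_sup phi); exact: interval_is_sup.
Qed.

Context (hS : condition_S T).

Lemma imp_lt_isup a A r : a != isup A -> A !=set0 -> r < imp T a (isup A) ->
  exists2 b, A b & r < imp T a b.
Proof.
move=> aA; apply: (continuous_lt_isup (h := imp T a)).
exact: (@continuous_at_pair R (fun p => imp T p.1 p.2) _ _ (hS aA)).
Qed.

(** The limit inferior of the net generating [lam] bounds its supremum.  When it
    is at most [b < a], continuity of the implication at a point off the
    diagonal lets the implication commute with that limit. *)
Lemma imp_interval_sup_le (lam : I -> I) a b :
  forward_cauchy_weight (X := interval_order) lam -> b < a ->
  imp T a (interval_sup lam) <= lam b.
Proof.
move=> [_ [J [leJ [u [dJ _ ->]]]]] ba.
pose tail i := iinf [set u j | j in leJ i].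
pose liminf := isup (range tail).
have sup_le : interval_sup (net_weight leJ u) <= liminf.
  apply: isup_le => _ [x _ <-]; rewrite (tnormC hT).
  apply: (tnorm_isup_le hT) => _ [i _ <-].
  apply: le_trans (isup_ub _); last by exists i.
  apply: le_iinf => _ [j ij <-]; rewrite -(le_imp hT).
  by apply: iinf_lb; exists j.
apply: le_trans (imp_mono hT (lexx a) sup_le) _.
have tail_le i j : leJ i j -> tail i <= u j by move=> ij; apply: iinf_lb; exists j.
have [/lt_isup[_ [i _ <-] bi]|lb] := ltP b liminf.
  apply: le_trans (i01_le1 _) _.
  apply: (@le_net_weight _ _ _ _ _ _ _ _ i) => j ij /=.
  by rewrite (imp1 hT)//; apply: le_trans (ltW bi) _; exact: tail_le.
apply: le_of_lt => r rl.
have [_ [i _ <-] ri] : exists2 t, range tail t & r < imp T a t.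
  apply: imp_lt_isup => //; first by rewrite gt_eqF// (le_lt_trans lb ba).
  by have [i] := directed_inhabited dJ; exists (tail i), i.
apply: (@le_net_weight _ _ _ _ _ _ _ _ i) => j ij /=.
apply: le_trans (ltW ri) _; apply: (imp_mono hT); first exact: ltW.
exact: tail_le.
Qed.

(** The left adjoint of the supremum sends [a] to the ideal generated by the
    points below [a]; the point 0 is added to keep the generating net non-empty
    when [a] is 0. *)
Lemma interval_domain : idomain01 interval_order.
Proof.
split; first exact: interval_separated.
exists (fun lam => interval_sup (sval lam)); split.
  by move=> lam y; rewrite interval_is_sup.
pose J a := {b : I | b < a \/ forall x, b <= x}.
pose leJ a (b b' : J a) := sval b <= sval b'.
pose u a (b : J a) : interval_order := sval b.
have dJ a : directed (leJ a).
  split=> [|b|b1 b2 b3|b b'].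
  - by exists; exists 0%:i01; right; exact: i01_ge0.
  - exact: lexx.
  - exact: le_trans.
  - have [bb'|/ltW b'b] := leP (sval b) (sval b').
      by exists b'; split=> //; exact: lexx.
    by exists b; split=> //; exact: lexx.
have mono a (b b' : J a) : leJ a b b' -> ihom (u a b) (u a b') = 1%:i01.
  by move=> /(imp1 hT).
exists (fun a => exist _ _ (fcw_mono_net hT (dJ a) (mono a))) => a lam.
have [wlam _] := svalP lam.
rewrite [LHS](isub_isup_ihom hT (u a) wlam).
apply/eqP; rewrite eq_le; apply/andP; split.
  rewrite (le_imp hT) -{1}(isup_lt a) (tnormC hT).
  apply: (tnorm_isup_le hT) => b ba; apply: le_trans (isup_ub _); last by exists b.
  by apply: (tnorm_monol hT); apply: iinf_lb; exists (exist _ b (or_introl ba)).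
apply: le_iinf => _ [[b [ba|b0]] _ <-] /=.
  by apply: imp_interval_sup_le => //; exact: (svalP lam).
apply: le_trans (i01_le1 _) _; apply: le_of_lt => r r1.
have [lam1 _] := ideal_of_fcw (svalP lam); have [y ry] := lam1 r r1.
apply: le_trans (ltW ry) _; apply: le_trans (wlam b y).
by rewrite /= (imp1 hT)// (tnorm1r hT).
Qed.

Theorem interval_continuous_lattice : continuous_lattice interval_order.
Proof. by split; [exact: interval_complete | exact: interval_domain]. Qed.

(** Only the empty set needs a separate clause: its infimum is 1, and [imp T 1 x]
    is [x] instead of 0. *)
Definition inf_dist x A : I :=
  if `[< A !=set0 >] then imp T (iinf A) x else 0%:i01.

Lemma inf_distE x A : A !=set0 -> inf_dist x A = imp T (iinf A) x.
Proof. by move=> A0; rewrite /inf_dist asboolT. Qed.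

Lemma inf_dist0 x : inf_dist x set0 = 0%:i01.
Proof. by rewrite /inf_dist asboolF// => -[]. Qed.

Lemma inf_dist_approach : approach T inf_dist.
Proof.
split=> [x|x|x A B|x A B].
- by rewrite inf_distE ?iinf_set1 ?(imp1 hT)//; exists x.
- exact: inf_dist0.
- have [->|/set0P A0] := eqVneq A set0.
    by rewrite set0U inf_dist0; apply/esym/max_idPr; exact: i01_ge0.
  have [->|/set0P B0] := eqVneq B set0.
    by rewrite setU0 inf_dist0; apply/esym/max_idPl; exact: i01_ge0.
  have AB0 : (A `|` B) !=set0 by case: A0 => a Aa; exists a; left.
  rewrite !inf_distE//; apply/eqP; rewrite eq_le; apply/andP; split; last first.
    rewrite ge_max; apply/andP; split; apply: (imp_mono hT) => //.
      by apply: le_iinf => a Aa; apply: iinf_lb; left.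
    by apply: le_iinf => a Aa; apply: iinf_lb; right.
  rewrite le_max; apply/orP; have [AB|/ltW BA] := leP (iinf A) (iinf B).
    left; apply: (imp_mono hT) => //; apply: le_iinf => a [/iinf_lb//|/iinf_lb].
    exact: le_trans.
  right; apply: (imp_mono hT) => //; apply: le_iinf => a [/iinf_lb|/iinf_lb//].
  exact: le_trans.
- have [->|/set0P B0] := eqVneq B set0.
    by rewrite inf_dist0 (tnorm0r hT) i01_ge0.
  have [A0|/set0P A0] := eqVneq A set0.
    have [b Bb] := B0; apply: le_trans (tnorm_le_l hT _ _) _.
    apply: le_trans (iinf_lb _) _; first by exists b.
    by rewrite A0 !inf_dist0.
  rewrite !inf_distE//; apply: le_trans (imp_trans hT (iinf A) (iinf B) x).
  apply: (tnorm_monol hT); rewrite (le_imp hT); apply: le_iinf => b Bb.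
  by rewrite -(le_imp hT); apply: iinf_lb; exists b => //; rewrite inf_distE.
Qed.

(** Extend [y |-> imp T y a] from the two points 1 and [a] to the interval with
    [inf_dist].  The extension is at most [imp T t a] at [t], because the distance
    of [t] to the point 1 is [t]; and its supremum over the points above [a] is 1,
    its value at [a], because [a] is in the closure of these points. *)
Lemma imp_near_diagonal a r :
  injective_space T (@scott_dist R T interval_order) ->
  a < 1%:i01 -> r < 1%:i01 -> exists2 t, a < t & r < imp T t a.
Proof.
move=> [_ inj] a1 r1.
pose Y : set I := [set y | y = a \/ forall x, x <= y].
pose f (y : Y) : interval_order := imp T (set_val y) a.
have Ya : Y a by left.
have Y1 : Y 1%:i01 by right; exact: i01_le1.
have YP (y : Y) : set_val y = a \/ set_val y = 1%:i01.
  have [->|y1] : Y (set_val y) by exact: set_valP.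
    by left.
  by right; exact: i01_ge1.
have cf : approach_continuous (subspace_dist inf_dist (Y:=Y))
    (@scott_dist R T interval_order) f.
  move=> y A; have [->|/set0P A0] := eqVneq A set0.
    by rewrite /subspace_dist image_set0 inf_dist0 i01_ge0.
  have [b Ab bmin] : exists2 b, A b & set_val b <= iinf (set_val @` A).
    have [[b Ab ba]|noa] := pselect (exists2 b, A b & set_val b = a).
      exists b => //; apply: le_iinf => _ [b' _ <-]; rewrite ba.
      by have [->|->] := YP b'; [|exact: i01_le1].
    have [b Ab] := A0; exists b => //; apply: le_iinf => _ [b' Ab' <-].
    have [b'a|->] := YP b'; last exact: i01_le1.
    by exfalso; apply: noa; exists b'.
  rewrite /subspace_dist inf_distE; last by have [c Ac] := A0; exists (set_val c), c.
  apply: le_trans (imp_mono hT bmin (lexx _)) _.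
  apply: le_trans
    (ihom_le_scott_dist hT (X := interval_order) (a := f b) _ _); last by exists b.
  by rewrite /= (le_imp hT) (tnormC hT); exact: imp_trans.
have [g [cg gf]] := inj I inf_dist inf_dist_approach Y f cf.
have g1 : g 1%:i01 = a by rewrite (gf (SigSub (mem_set Y1))) /f /= (imp1l hT).
have ga : g a = 1%:i01 by rewrite (gf (SigSub (mem_set Ya))) /f /= (imp1 hT).
have g_le t : g t <= imp T t a.
  rewrite (le_imp hT) (tnormC hT) -(le_imp hT).
  have t1 : inf_dist t [set 1%:i01] = t.
    by rewrite inf_distE ?iinf_set1 ?(imp1l hT)//; exists 1%:i01.
  rewrite -{1}t1; apply: le_trans (cg t _) _.
  apply: (scott_dist_le _ (scott_closed_ihom (X := interval_order) a)) => _ [_ -> <-] /=.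
  by rewrite g1 (imp1 hT).
pose A := [set t | a < t].
have A0 : A !=set0 by exists 1%:i01.
have sup1 : isup (g @` A) = 1%:i01.
  apply: i01_ge1; have := cg a A.
  rewrite inf_distE// iinf_gt// (imp1 hT)// ga => /le_trans; apply.
  rewrite -[leRHS](imp1l hT).
  apply: (scott_dist_le _ (scott_closed_ihom (X := interval_order) (isup (g @` A)))).
  by move=> x gx; apply: (imp1 hT); exact: isup_ub.
have [_ [t at_ <-] rt] : exists2 t, (g @` A) t & r < t by apply: lt_isup; rewrite sup1.
by exists t => //; apply: lt_le_trans rt (g_le t).
Qed.

End IntervalLattice.

(** * A characterization of the Lukasiewicz t-norm *)

Section Powers.
Context {R : realType} (T : {i01 R} -> {i01 R} -> {i01 R}).
Context (hT : continuous_tnorm T).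
Local Notation I := {i01 R}.
Implicit Types (x y z e p q r t u : I) (n m k l : nat).

Local Notation tpow := (tpow T).

Lemma tpowS x n : tpow x n.+1 = T x (tpow x n). Proof. by []. Qed.

Lemma tpow1 x : tpow x 1 = x. Proof. exact: tnorm1r. Qed.

Lemma tpowD x n m : tpow x (n + m) = T (tpow x n) (tpow x m).
Proof.
elim: n => [|n IH]; first by rewrite (tnorm1 hT).
by rewrite addSn !tpowS IH (tnormA hT).
Qed.

Lemma tpow_sqr x n : tpow (T x x) n = tpow x n.*2.
Proof. by elim: n => // n IH; rewrite doubleS !tpowS IH (tnormA hT). Qed.

Lemma tpow_le x n m : (n <= m)%N -> tpow x m <= tpow x n.
Proof. by move=> /subnKC <-; rewrite tpowD; exact: tnorm_le_l. Qed.

Lemma tpow_lt1 x n : tpow x n < 1%:i01 -> x < 1%:i01.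
Proof.
rewrite !lt_neqAle !i01_le1 !andbT; apply: contra => /eqP ->.
by elim: n => // n; rewrite tpowS (tnorm1 hT).
Qed.

(** The supremum of the elements of square at most [x] is also the infimum of
    those of square above [x], so that continuity bounds its square on both
    sides. *)
Lemma tnorm_sqrt x : exists y, T y y = x.
Proof.
pose A := [set y | T y y <= x].
have sqrle y y' z : T y y <= z -> T y' y' <= z -> T y y' <= z.
  move=> yz y'z; have [yy'|/ltW y'y] := leP y y'.
    by apply: le_trans (tnorm_monol hT _ yy') _.
  by apply: le_trans (tnorm_monor hT _ y'y) _.
have sqrge y y' z : z <= T y y -> z <= T y' y' -> z <= T y y'.
  move=> yz y'z; have [yy'|/ltW y'y] := leP y y'.
    by apply: le_trans yz _; exact: (tnorm_monor hT).
  by apply: le_trans y'z _; exact: (tnorm_monol hT).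
exists (isup A); apply/eqP; rewrite eq_le; apply/andP; split.
  apply: (tnorm_isup_le hT) => a Aa; rewrite (tnormC hT).
  by apply: (tnorm_isup_le hT) => b Ab; exact: sqrle.
have [A1|] := boolP (isup A < 1%:i01); last first.
  by rewrite -leNgt => /i01_ge1 ->; rewrite (tnorm1 hT) i01_le1.
rewrite -{1 2}(iinf_gt A1); set B := [set s | _].
have B0 : B !=set0 by exists 1%:i01.
have Bx b : B b -> x <= T b b.
  by move=> Bb; rewrite leNgt; apply/negP => /ltW/(@isup_ub _ A); rewrite leNgt Bb.
apply: (le_tnorm_iinf hT) => // b Bb; rewrite (tnormC hT).
by apply: (le_tnorm_iinf hT) => // c Bc; apply: sqrge; exact: Bx.
Qed.

Context (idem : forall e, T e e = e -> e = 0%:i01 \/ e = 1%:i01).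

(** A value fixed by [x] lies below every power of [x], and the infimum of these
    powers is idempotent. *)
Lemma tnorm_fix x e : x < 1%:i01 -> T x e = e -> e = 0%:i01.
Proof.
move=> x1 xe; pose q := iinf (range (tpow x)).
have q0 : range (tpow x) !=set0 by exists (tpow x 0), 0%N.
have qx : q <= x by rewrite -[leRHS]tpow1; apply: iinf_lb; exists 1%N.
have qq : T q q = q.
  apply/eqP; rewrite eq_le (tnorm_le_l hT) /=.
  apply: (le_tnorm_iinf hT) => // _ [n _ <-]; rewrite (tnormC hT).
  apply: (le_tnorm_iinf hT) => // _ [m _ <-]; rewrite -tpowD.
  by apply: iinf_lb; exists (n + m)%N.
have [q00|q1] := idem qq; last by move: x1; rewrite ltNge -q1 qx.
apply: i01_le0; rewrite -q00; apply: le_iinf => _ [n _ <-].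
elim: n => [|n IH]; first exact: i01_le1.
by rewrite -xe tpowS; exact: (tnorm_monor hT).
Qed.

Context (m0 : I) (m0_gt0 : 0%:i01 < m0) (m0_sqr : T m0 m0 = 0%:i01).

(** The largest element of square 0 is what the isomorphism must send to 1/2. *)
Definition half : I := isup [set y | T y y <= 0%:i01].

Lemma half_sqr : T half half = 0%:i01.
Proof.
apply: i01_le0; apply: (tnorm_isup_le hT) => a a0; rewrite (tnormC hT).
apply: (tnorm_isup_le hT) => b b0; have [ab|/ltW ba] := leP a b.
  by apply: le_trans b0; exact: (tnorm_monol hT).
by apply: le_trans a0; exact: (tnorm_monor hT).
Qed.

Lemma le_half x : T x x = 0%:i01 -> x <= half.
Proof. by move=> x0; apply: isup_ub; rewrite /= x0. Qed.

Lemma half_gt0 : 0%:i01 < half.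
Proof. exact: lt_le_trans m0_gt0 (le_half m0_sqr). Qed.

Definition tsqrt x : I := xget 0%:i01 [set y | T y y = x].

Lemma tsqrtK x : T (tsqrt x) (tsqrt x) = x.
Proof. by rewrite /tsqrt; case: xgetP => [y _ //|no]; have [y /no] := tnorm_sqrt x. Qed.

Definition root k : I := iter k tsqrt half.

Lemma root_double k n : tpow (root k.+1) n.*2 = tpow (root k) n.
Proof. by rewrite -tpow_sqr tsqrtK. Qed.

Lemma root_refine k l n : tpow (root (k + l)) (n * 2 ^ l) = tpow (root k) n.
Proof.
elim: l => [|l IH]; first by rewrite addn0 muln1.
by rewrite addnS expnS mulnCA mul2n root_double.
Qed.

Lemma root_half k : tpow (root k) (2 ^ k) = half.
Proof. by have := root_refine 0 k 1; rewrite mul1n tpow1 add0n. Qed.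

Lemma root_lt1 k : root k < 1%:i01.
Proof.
apply: (@tpow_lt1 _ (2 ^ k)); rewrite root_half ltNge; apply/negP => /i01_ge1 h1.
by have := half_gt0; rewrite -half_sqr h1 (tnorm1 hT) ltxx.
Qed.

Lemma root_top k : tpow (root k) (2 ^ k.+1) = 0%:i01.
Proof. by rewrite expnS mul2n -addnn tpowD root_half half_sqr. Qed.

(** The powers of a root reach 0 no earlier than at [2 ^ k.+1]:
    otherwise, with [y] the quotient of [half] by [root k] and [p] a square root
    of [root k], the square of [T y p] would be 0, so [T y p] would not exceed
    [half], and multiplication by [p] would fix [half]. *)
Lemma root_pred_neq0 k : tpow (root k) (2 ^ k.+1).-1 != 0%:i01.
Proof.
apply/eqP; have -> : (2 ^ k.+1).-1 = (2 ^ k + (2 ^ k).-1)%N.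
  rewrite expnS mul2n -addnn; case: (2 ^ k)%N (expn_gt0 2 k) => // i _.
  by rewrite /= addnS.
rewrite tpowD root_half; set y := tpow _ _ => hy.
have wy : T (root k) y = half.
  by rewrite -(root_half k) /y -tpowS prednK// expn_gt0.
have [p pw] := tnorm_sqrt (root k).
have p1 : p < 1%:i01.
  by apply: (@tpow_lt1 _ 2); rewrite /tpow /= (tnorm1r hT) pw root_lt1.
have x0 : T (T y p) (T y p) = 0%:i01.
  rewrite (tnormC hT y) (tnormA hT) -(tnormA hT p) (tnormC hT y) (tnormA hT) pw.
  by rewrite wy.
have px : T p (T y p) = half by rewrite (tnormC hT y) (tnormA hT) pw.
have ph : T p half = half.
  apply/eqP; rewrite eq_le (tnorm_le_r hT) /= -{1}px.
  by apply: (tnorm_monor hT); exact: le_half.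
by have := half_gt0; rewrite (tnorm_fix p1 ph) ltxx.
Qed.

Lemma root_neq0 k n : (n < 2 ^ k.+1)%N -> tpow (root k) n != 0%:i01.
Proof.
move=> nk; apply: contra (root_pred_neq0 k) => /eqP n0.
apply/eqP; apply: i01_le0; rewrite -n0; apply: tpow_le.
by rewrite -ltnS prednK// expn_gt0.
Qed.

Lemma root_strict k n m : (n < m)%N -> (n < 2 ^ k.+1)%N ->
  tpow (root k) m < tpow (root k) n.
Proof.
move=> nm nk; apply: (@le_lt_trans _ _ (tpow (root k) n.+1)).
  exact: tpow_le.
rewrite lt_neqAle tpow_le// andbT tpowS; apply: contra (root_neq0 nk) => /eqP fx.
by apply/eqP; exact: (tnorm_fix (root_lt1 k) fx).
Qed.

Lemma isup_root : isup (range root) = 1%:i01.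
Proof.
set q := isup _; have rootq k : root k <= q by apply: isup_ub; exists k.
have qq : T q q = q.
  apply/eqP; rewrite eq_le (tnorm_le_l hT) /=; apply: isup_le => _ [k _ <-].
  by rewrite -[root k]tsqrtK; apply: (tnorm_mono hT); exact: (rootq k.+1).
have [q0|//] := idem qq.
by have := lt_le_trans half_gt0 (rootq 0%N); rewrite q0 ltxx.
Qed.

(** The graph, over the dyadic numbers of the unit interval, of the exponential
    [q |-> half ^ (2 q)]. *)
Definition dyadic_exp (q : R) z : Prop :=
  exists k n, [/\ (n <= 2 ^ k.+1)%N, q = n%:R / (2 ^ k.+1)%:R & z = tpow (root k) n].

Lemma dyadic_exp_common (q q' : R) z z' : dyadic_exp q z -> dyadic_exp q' z' ->
  exists k n n', [/\ (n <= 2 ^ k.+1)%N, (n' <= 2 ^ k.+1)%N,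
    q = n%:R / (2 ^ k.+1)%:R /\ q' = n'%:R / (2 ^ k.+1)%:R &
    z = tpow (root k) n /\ z' = tpow (root k) n'].
Proof.
move=> [k [n [nk -> ->]]] [l [m [ml -> ->]]].
have pow2_neq0 i : (2 ^ i)%:R != 0 :> R by rewrite pnatr_eq0 -lt0n expn_gt0.
exists (k + l)%N, (n * 2 ^ l)%N, (m * 2 ^ k)%N; split.
- by rewrite -addSn expnD leq_mul2r nk orbT.
- by rewrite -addnS addnC expnD leq_mul2r ml orbT.
- split.
    by rewrite -addSn expnD !natrM -mulf_div divff ?mulr1.
  by rewrite -addnS addnC expnD !natrM -mulf_div divff ?mulr1.
- by split; [rewrite root_refine | rewrite addnC root_refine].
Qed.

Lemma dyadic_exp_le (q q' : R) z z' : dyadic_exp q z -> dyadic_exp q' z' ->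
  (q <= q') = (z' <= z).
Proof.
move=> h h'; have [k [n [n' [nk n'k [-> ->] [-> ->]]]]] := dyadic_exp_common h h'.
rewrite ler_pM2r ?invr_gt0 ?ltr0n ?expn_gt0// ler_nat.
apply/idP/idP => [|zz]; first exact: tpow_le.
rewrite leqNgt; apply/negP => n'n.
by have := root_strict n'n (leq_trans n'n nk); rewrite ltNge zz.
Qed.

Lemma dyadic_exp_lt (q q' : R) z z' : dyadic_exp q z -> dyadic_exp q' z' ->
  (q < q') = (z' < z).
Proof. by move=> h h'; rewrite !ltNge (dyadic_exp_le h' h). Qed.

Lemma dyadic_expD (q q' : R) z z' : dyadic_exp q z -> dyadic_exp q' z' ->
  q + q' <= 1 -> dyadic_exp (q + q') (T z z').
Proof.
move=> h h'; have [k [n [n' [nk n'k [-> ->] [-> ->]]]]] := dyadic_exp_common h h'.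
rewrite -mulrDl -natrD ler_pdivrMr ?ltr0n ?expn_gt0// mul1r ler_nat => nn'k.
by exists k, (n + n')%N; split=> //; rewrite tpowD.
Qed.

Lemma dyadic_expD0 (q q' : R) z z' : dyadic_exp q z -> dyadic_exp q' z' ->
  1 <= q + q' -> T z z' = 0%:i01.
Proof.
move=> h h'; have [k [n [n' [nk n'k [-> ->] [-> ->]]]]] := dyadic_exp_common h h'.
rewrite -mulrDl -natrD ler_pdivlMr ?ltr0n ?expn_gt0// mul1r ler_nat => nn'k.
by apply: i01_le0; rewrite -tpowD -(root_top k); exact: tpow_le.
Qed.

Lemma dyadic_exp0 : dyadic_exp 0 1%:i01.
Proof. by exists 0%N, 0%N; split=> //; rewrite mul0r. Qed.

Lemma dyadic_exp1 : dyadic_exp 1 0%:i01.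
Proof.
exists 0%N, 2%N; split=> //; first by rewrite divff// pnatr_eq0.
by rewrite -(root_top 0).
Qed.

(** Consecutive powers of a root close to 1 are close to each other, uniformly:
    hence the first power of it that is at most [y] is above [x]. *)
Lemma dyadic_exp_dense x y : x < y -> exists (q : R) z, [/\ dyadic_exp q z, x < z & z <= y].
Proof.
move=> xy.
have [_ [k _ <-] xk] : exists2 r, range root r & x < T y r.
  by apply: (tnorm_lt_isup hT); rewrite isup_root (tnorm1r hT).
have ex : exists n, tpow (root k) n <= y by exists (2 ^ k.+1)%N; rewrite root_top i01_ge0.
case: (ex_minnP ex) => n ny nmin.
exists (n%:R / (2 ^ k.+1)%:R), (tpow (root k) n); split=> //.
  exists k, n; split=> //; by apply: nmin; rewrite root_top i01_ge0.
case: n ny nmin => [|n] ny nmin.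
  by apply: lt_le_trans xy _; exact: i01_le1.
apply: lt_le_trans xk _; rewrite (tnormC hT) tpowS; apply: (tnorm_monor hT).
by rewrite leNgt; apply/negP => /ltW/nmin; rewrite ltnn.
Qed.

Lemma dyadic_exp_param_dense (s t : R) : 0 <= s -> s < t -> t <= 1 ->
  exists (q : R) z, [/\ dyadic_exp q z, s < q & q < t].
Proof.
move=> s0 st t1; have ts0 : 0 < t - s by rewrite subr_gt0.
pose k := Num.bound (t - s)^-1.
have N0 : 0 < (2 ^ k.+1)%:R :> R by rewrite ltr0n expn_gt0.
have step : (2 ^ k.+1)%:R^-1 < t - s.
  rewrite invf_plt ?posrE//.
  apply: lt_trans (archi_boundP _) _; first by rewrite invr_ge0 ltW.
  by rewrite ltr_nat -/k (leq_trans (ltnSn k))// ltnW// ltn_expl.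
have ex : exists n, s < n%:R / (2 ^ k.+1)%:R.
  exists (2 ^ k.+1)%N; rewrite divff ?gt_eqF//; exact: lt_le_trans st t1.
case: (ex_minnP ex) => n sn nmin.
exists (n%:R / (2 ^ k.+1)%:R), (tpow (root k) n); split=> //.
  exists k, n; split=> //; apply: nmin; rewrite divff ?gt_eqF//.
  exact: lt_le_trans st t1.
case: n sn nmin => [|n] sn nmin; first by rewrite mul0r (le_lt_trans s0 st).
have : n%:R / (2 ^ k.+1)%:R <= s.
  by rewrite leNgt; apply/negP => /nmin; rewrite ltnn.
rewrite -natr1 mulrDl mul1r; move: step; set e := _^-1; lra.
Qed.

(** The inverse of that exponential; it decreases from 1 at 0 to 0 at 1. *)
Definition tlog x : R := sup [set q : R | exists2 z, dyadic_exp q z & x <= z].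

Lemma tlog_has_sup x : has_sup [set q : R | exists2 z, dyadic_exp q z & x <= z].
Proof.
split; first by exists 0, 1%:i01; [exact: dyadic_exp0 | exact: i01_le1].
exists 1 => q [z hz _]; rewrite (dyadic_exp_le hz dyadic_exp1); exact: i01_ge0.
Qed.

Lemma le_tlog (q : R) z x : dyadic_exp q z -> x <= z -> q <= tlog x.
Proof. by move=> hz xz; apply: ub_le_sup; [case: (tlog_has_sup x) | exists z]. Qed.

Lemma tlog_le (q : R) z x : dyadic_exp q z -> z <= x -> tlog x <= q.
Proof.
move=> hz zx; apply: ge_sup; first by case: (tlog_has_sup x).
by move=> q' [z' hz' xz']; rewrite (dyadic_exp_le hz' hz) (le_trans zx).
Qed.

Lemma tlog_ge0 x : 0 <= tlog x.
Proof. exact: le_tlog dyadic_exp0 (i01_le1 x). Qed.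

Lemma tlog_le1 x : tlog x <= 1.
Proof. exact: tlog_le dyadic_exp1 (i01_ge0 x). Qed.

Lemma tlog0 : tlog 0%:i01 = 1.
Proof.
apply/eqP; rewrite eq_le tlog_le1; exact: le_tlog dyadic_exp1 (lexx _).
Qed.

Lemma tlog_lt x y : x < y -> tlog y < tlog x.
Proof.
move=> /i01_dense[x1 xx1 x1y].
have [q [z [hz x1z zy]]] := dyadic_exp_dense x1y.
have [q' [z' [hz' xz' z'x1]]] := dyadic_exp_dense xx1.
apply: (le_lt_trans (tlog_le hz zy)).
apply: (lt_le_trans _ (le_tlog hz' (ltW xz'))).
by rewrite (dyadic_exp_lt hz hz') (le_lt_trans z'x1).
Qed.

Lemma tlog_surj (t : R) : 0 <= t -> t <= 1 -> exists x, tlog x = t.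
Proof.
move=> t0 t1; pose A := [set z | exists2 q : R, dyadic_exp q z & q <= t].
exists (iinf A); apply/eqP; rewrite eq_le !leNgt; apply/andP; split; apply/negP.
  move=> tA; have [q1 [z1 [hz1 tq1 q1A]]] := dyadic_exp_param_dense t0 tA (tlog_le1 _).
  have : z1 <= iinf A.
    apply: le_iinf => z [q hz qt]; rewrite -(dyadic_exp_le hz hz1).
    exact: le_trans qt (ltW tq1).
  by move=> /(tlog_le hz1); rewrite leNgt q1A.
move=> At; have [q [z [hz Aq qt]]] := dyadic_exp_param_dense (tlog_ge0 _) At t1.
have zA : iinf A <= z by apply: iinf_lb; exists q => //; exact: ltW.
by have := le_tlog hz zA; rewrite leNgt Aq.
Qed.

(** Both inequalities compare [x] and [y] with values of the exponential, where
    the t-norm is addition of exponents by [dyadic_expD]. *)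
Lemma tlog_tnorm x y : tlog (T x y) = Num.min 1 (tlog x + tlog y).
Proof.
apply/eqP; rewrite eq_le; apply/andP; split.
  rewrite le_min tlog_le1 /= leNgt; apply/negP => lt_xy.
  have xy1 := tlog_le1 (T x y).
  pose e := (tlog (T x y) - (tlog x + tlog y)) / 3%:R.
  have e0 : 0 < e by rewrite divr_gt0 ?subr_gt0.
  have e3 : tlog x + tlog y + 3%:R * e = tlog (T x y).
    by rewrite /e mulrC divfK ?pnatr_eq0//; lra.
  have x0 := tlog_ge0 x; have y0 := tlog_ge0 y.
  have above (v : I) : tlog v + e <= 1 ->
      exists (q : R) z, [/\ dyadic_exp q z, z <= v & q < tlog v + e].
    move=> v1; have ve : tlog v < tlog v + e by rewrite ltrDl.
    have [q [z [hz vq qe]]] := dyadic_exp_param_dense (tlog_ge0 v) ve v1.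
    exists q, z; split=> //; rewrite leNgt; apply/negP => /ltW/(le_tlog hz).
    by rewrite leNgt vq.
  have [|q [z [hz zx qx]]] := above x; first by lra.
  have [|q' [z' [hz' zy qy]]] := above y; first by lra.
  have qq1 : q + q' <= 1 by lra.
  have := tlog_le (dyadic_expD hz hz' qq1) (tnorm_mono hT zx zy); lra.
rewrite leNgt; apply/negP; rewrite lt_min => /andP[lt1 ltxy].
pose e := (tlog x + tlog y - tlog (T x y)) / 2%:R.
have e0 : 0 < e by rewrite divr_gt0 ?subr_gt0.
have e2 : tlog (T x y) + 2%:R * e = tlog x + tlog y.
  by rewrite /e mulrC divfK ?pnatr_eq0//; lra.
have below (v : I) : exists (q : R) z, [/\ dyadic_exp q z, v <= z & tlog v - e < q].
  by have [q [z hz vz] eq] := sup_adherent e0 (tlog_has_sup v); exists q, z.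
have [q [z [hz xz qx]]] := below x; have [q' [z' [hz' yz qy]]] := below y.
have Txy := tnorm_mono hT xz yz.
have [qq1|/ltW qq1] := leP (q + q') 1.
  have := le_tlog (dyadic_expD hz hz' qq1) Txy; lra.
move: lt1; rewrite (_ : T x y = 0%:i01) ?tlog0 ?ltxx//.
by apply: i01_le0; rewrite -(dyadic_expD0 hz hz' qq1).
Qed.

(** Since [tlog] turns the t-norm into truncated addition, [1 - tlog] turns it
    into the Lukasiewicz t-norm. *)
Theorem tnorm_isomorphic_lukasiewicz : tnorm_isomorphic T (@lukasiewicz R).
Proof.
have th0 x : 0 <= 1 - tlog x by rewrite subr_ge0 tlog_le1.
have th1 x : 1 - tlog x <= 1 by rewrite gerBl tlog_ge0.
pose theta x : I := Itv01 (th0 x) (th1 x).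
have theta_mono : {mono theta : x y / x <= y}.
  move=> x y; rewrite -num_le /= lerD2l lerN2.
  have [xy|/tlog_lt yx] := leP x y; last by rewrite leNgt yx.
  have [->|nxy] := eqVneq x y; first exact: lexx.
  by apply: ltW; apply: tlog_lt; rewrite lt_neqAle nxy.
have theta_surj y : exists x, theta x = y.
  have [||x hx] := @tlog_surj (1 - y%:num); [by rewrite subr_ge0 le1|by rewrite gerBl ge0|].
  by exists x; apply: val_inj; rewrite /= hx subKr.
have [eta etaK] := choice theta_surj.
have theta_inj : injective theta.
  by move=> x y xy; apply/eqP; rewrite eq_le -(theta_mono x y) -(theta_mono y x) xy lexx.
exists theta; split=> //.
  by exists eta => // x; apply: theta_inj; rewrite etaK.
move=> x y; apply: val_inj; rewrite /= tlog_tnorm.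
rewrite /Num.min /Num.max; case: ifPn; case: ifPn; rewrite -?leNgt; lra.
Qed.

End Powers.

Section Lukasiewicz.
Context {R : realType} (T : {i01 R} -> {i01 R} -> {i01 R}).
Context (hT : continuous_tnorm T).
Local Notation I := {i01 R}.
Context (theta : I -> I) (theta_bij : bijective theta).
Context (theta_mono : {mono theta : x y / x <= y}).
Context (theta_morph : {morph theta : x y / T x y >-> lukasiewicz x y}).
Implicit Types (x y z r : I).

Lemma theta0 : theta 0%:i01 = 0%:i01.
Proof.
have [eta thetaK etaK] := theta_bij; apply: i01_le0.
by rewrite -[leRHS]etaK theta_mono i01_ge0.
Qed.

Lemma theta1 : theta 1%:i01 = 1%:i01.
Proof.
have [eta thetaK etaK] := theta_bij; apply: i01_ge1.
by rewrite -[leLHS]etaK theta_mono i01_le1.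
Qed.

Lemma lukasiewiczE x y : (lukasiewicz x y)%:num = Num.max 0 (x%:num + y%:num - 1).
Proof. by []. Qed.

Lemma theta_neg x : (theta (tnorm_neg T x))%:num = 1 - (theta x)%:num.
Proof.
have [eta thetaK etaK] := theta_bij.
have h0 : 0 <= 1 - (theta x)%:num by rewrite subr_ge0 le1.
have h1 : 1 - (theta x)%:num <= 1 by rewrite gerBl ge0.
have negE z : (z <= tnorm_neg T x) = (z <= eta (Itv01 h0 h1)).
  rewrite (le_imp hT) -[RHS]theta_mono etaK -[LHS]theta_mono theta0 theta_morph.
  rewrite -!num_le lukasiewiczE /= ge_max lexx /=.
  by rewrite subr_le0 lerBrDl.
suff -> : tnorm_neg T x = eta (Itv01 h0 h1) by rewrite etaK.
by apply/eqP; rewrite eq_le -negE lexx negE lexx.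
Qed.

Lemma lukasiewicz_negK x : tnorm_neg T (tnorm_neg T x) = x.
Proof.
apply: (bij_inj theta_bij); apply: val_inj => /=.
by rewrite !theta_neg subKr.
Qed.

(** In the Lukasiewicz interval each multiplication by [r] lowers the value by
    the same amount [1 - r]. *)
Lemma lukasiewicz_nilpotent r : r < 1%:i01 -> exists n, tpow T r n = 0%:i01.
Proof.
move=> r1; pose e := 1 - (theta r)%:num.
have e0 : 0 < e.
  rewrite subr_gt0; have : theta r < theta 1%:i01.
    by rewrite (leW_mono theta_mono).
  by rewrite theta1 -num_lt.
have powE n : (theta (tpow T r n))%:num = Num.max 0 (1 - n%:R * e).
  elim: n => [|n IH].
    by rewrite mul0r subr0 /tpow /= theta1 /=; apply/esym/max_idPr.
  rewrite tpowS theta_morph lukasiewiczE IH -natr1 mulrDl mul1r.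
  have -> : (theta r)%:num = 1 - e by rewrite subKr.
  move: (n%:R * e) => p.
  rewrite /Num.max; case: ifPn; case: ifPn; case: ifPn; rewrite -?leNgt; lra.
exists (Num.bound e^-1); apply: (bij_inj theta_bij); apply: val_inj.
rewrite [LHS]powE theta0 /=; apply/max_idPl; rewrite subr_le0.
rewrite -ler_pdivrMr// div1r ltW// archi_boundP// invr_ge0 ltW//.
Qed.

End Lukasiewicz.

(** * The equivalence *)

Section Idempotents.
Context {R : realType} (T : {i01 R} -> {i01 R} -> {i01 R}).
Context (hT : continuous_tnorm T) (hS : condition_S T).
Local Notation I := {i01 R}.
Context (near_diagonal : forall a r : I, a < 1%:i01 -> r < 1%:i01 ->
  exists2 t, a < t & r < imp T t a).

(** If [a] is idempotent and [0 < a < 1], some [t] above [a] has [a < imp T t a].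
    Continuity at [(t, a)], off the diagonal, gives [a < imp T t y] with [y < a],
    hence [a = T a a <= T t a <= y]. *)
Lemma idempotent_trivial (a : I) : T a a = a -> a = 0%:i01 \/ a = 1%:i01.
Proof.
move=> aa; have [->|a0] := eqVneq a 0%:i01; first by left.
have [->|a1] := eqVneq a 1%:i01; first by right.
have alt1 : a < 1%:i01 by rewrite lt_neqAle a1 i01_le1.
have agt0 : 0%:i01 < a by rewrite lt_neqAle eq_sym a0 i01_ge0.
have [t ta ati] := near_diagonal alt1 alt1; exfalso.
have [y ya aty] : exists2 y, y < a & a < imp T t y.
  apply: (imp_lt_isup hS (A := [set s | s < a])); rewrite ?isup_lt//.
    by rewrite gt_eqF.
  by exists 0%:i01.
have : T t a <= y by rewrite -(le_imp hT) ltW.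
rewrite leNgt => /negP; apply; apply: lt_le_trans ya _.
by rewrite -{1}aa; apply: (tnorm_monol hT); exact: ltW.
Qed.

Lemma square_zero_exists : exists2 m : I, 0%:i01 < m & T m m = 0%:i01.
Proof.
have [t t0 tc] := near_diagonal (@i01_lt01 R) (@i01_lt01 R).
exists (Order.min t (imp T t 0%:i01)); first by rewrite lt_min t0 tc.
apply: i01_le0; apply: le_trans (imp_app hT t 0%:i01).
by apply: (tnorm_mono hT); rewrite ge_min lexx ?orbT.
Qed.

End Idempotents.

Theorem theorem6p17 (R : realType) (T : {i01 R} -> {i01 R} -> {i01 R})
    (hT : continuous_tnorm T) (hS : condition_S T) :
  tnorm_isomorphic T (@lukasiewicz R) <->
  (forall X : iorder T,
     continuous_lattice X -> injective_space T (@scott_dist R T X)).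
Proof.
split=> [[theta [tbij tmono tmorph]] X [comX [_ [s [hs [d hd]]]]]|inj].
  split; first exact: scott_approach.
  move=> Y dY hY A f cf.
  exact: (extension_exists hT (lukasiewicz_negK hT tbij tmono tmorph)
    (lukasiewicz_nilpotent tbij tmono tmorph) comX hs hd hY cf).
have near a r := imp_near_diagonal (a := a) (r := r)
  (inj _ (interval_continuous_lattice hT hS)).
have [m m0 mm] := square_zero_exists hT near.
exact: (tnorm_isomorphic_lukasiewicz hT (idempotent_trivial hT hS near) m0 mm).
Qed.
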